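(* Let $d\in\mathbb{N}$, let $X_S=\{\mathrm{x}_1,\dots,\mathrm{x}_{d-1}\}$ be a solution of the E-system, parametrized by the non-empty subset $S$ of $\mathbb{Z}/d\mathbb{Z}$, and let $\mathrm{tr}_S$ be the corresponding specialized Juyumaya trace on the Yokonuma-Hecke algebras $\mathrm{Y}_{d,n}(u)$ with parameter $z$. Let $\tau$ be the Ocneanu trace on the Iwahori-Hecke algebras $\mathcal{H}_n(q)$ with parameter $\zeta$, and let $E=\mathrm{tr}_S(e_i)$ (which does not depend on $i$). Let $P$ be the link invariant obtained from $\tau$ and $\Delta_S$ the link invariant obtained from $\mathrm{tr}_S$. Then there exist scalars $(c_n)_{n\in\mathbb{N}}$ in $\mathbb{C}(q,\zeta,u,z,E)$ such that, for all $n\in\mathbb{N}$, $$P(\widehat\alpha)=c_n\,\Delta_S(\widehat\alpha)\qquad(\alpha\in B_n)$$ if and only if $P=\Delta_S$, that is, if and only if $(q,\zeta,u,z,E)$ satisfy one of the following (where any parameter among $q,\zeta,u,z$ on which no condition is listed is an arbitrary element of $\mathbb{C}^*$, and $E$ is arbitrary when not mentioned): (1) $q=1$, $\zeta=z$, $u=1$; (2) $q=1$, $\zeta=-z$, $u=1$; (3) $\zeta=q$, $u=1$, $z=1$; (4) $\zeta=q$, $u=1$, $z=-1$; (5) $\zeta=-1$, $u=1$, $z=1$; (6) $\zeta=-1$, $u=1$, $z=-1$; (7) $q=1$, $\zeta=E$, $z=-E$; (8) $q=1$, $\zeta=-E$, $z=-E$; (9) $\zeta=q$, $z=-1$, $E=1$;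 (10) $\zeta=q$, $z=u$, $E=1$; (11) $\zeta=-1$, $z=-1$, $E=1$; (12) $\zeta=-1$, $z=u$, $E=1$; (13) $q=u$, $\zeta=z$, $E=1$; (14) $q=1/u$, $\zeta=-z/u$, $E=1$.
   Context: Parameters: $q,\zeta,u,z\in\mathbb{C}^*=\mathbb{C}\setminus\{0\}$ (trace parameters $\zeta,z$ specialized to complex numbers, so that the field $\mathbb{C}(q,\zeta,u,z,E)$ is $\mathbb{C}$), such that $\lambda_{\mathcal H}:=\frac{\zeta+(1-q)}{q\zeta}$ and $\lambda_{\mathrm Y}:=\frac{z+(1-u)E}{uz}$ are nonzero. Iwahori-Hecke algebra $\mathcal{H}_n(q)$: the associative $\mathbb{C}$-algebra generated by $G_1,\dots,G_{n-1}$ with relations $G_iG_j=G_jG_i$ for $|i-j|>1$, $G_{i+1}G_iG_{i+1}=G_iG_{i+1}G_i$, $G_i^2=(q-1)G_i+q$. We use the natural inclusions $\mathcal{H}_n(q)\subset\mathcal{H}_{n+1}(q)$, $\mathcal H_0(q)=\mathbb C$. The Ocneanu trace with parameter $\zeta$ is the unique linear map $\tau$ on $\bigcup_n\mathcal{H}_n(q)$ with $\tau(hh')=\tau(h'h)$, $\tau(1)=1$, $\tau(hG_n)=\zeta\,\tau(h)$ for $h,h'\in\mathcal{H}_n(q)$ and all $n$. Yokonuma-Hecke algebra $\mathrm{Y}_{d,n}(u)$: the associative $\mathbb{C}$-algebra generated by $g_1,\dots,g_{n-1},t_1,\dots,t_n$ with relations $g_ig_j=g_jg_i$ for $|i-j|>1$;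 $g_ig_jg_i=g_jg_ig_j$ for $|i-j|=1$; $t_it_j=t_jt_i$; $t_jg_i=g_it_{s_i(j)}$ where $s_i=(i,i+1)$; $t_j^d=1$; and $g_i^2=1+(u-1)e_i+(u-1)e_ig_i$, where $e_i:=\frac1d\sum_{s=0}^{d-1}t_i^st_{i+1}^{-s}$. We use the natural inclusions $\mathrm{Y}_{d,n}(u)\subset\mathrm{Y}_{d,n+1}(u)$, $\mathrm Y_{d,0}(u)=\mathbb C$. The Juyumaya trace with parameters $z,x_1,\dots,x_{d-1}$ is the unique linear map $\mathrm{tr}$ on $\bigcup_n\mathrm{Y}_{d,n}(u)$ with $\mathrm{tr}(ab)=\mathrm{tr}(ba)$, $\mathrm{tr}(1)=1$, $\mathrm{tr}(ag_n)=z\,\mathrm{tr}(a)$, $\mathrm{tr}(at_{n+1}^m)=x_m\mathrm{tr}(a)$ ($1\le m\le d-1$) for $a,b\in\mathrm{Y}_{d,n}(u)$ and all $n$. E-system: the system $\sum_{s=0}^{d-1}x_{m+s}x_{d-s}=x_m\sum_{s=0}^{d-1}x_sx_{d-s}$ for $1\le m\le d-1$, with indices modulo $d$ and $x_0:=1$. Its complex solutions are parametrized by the non-empty subsets $S$ of $\mathbb{Z}/d\mathbb{Z}$; $\mathrm{tr}_S$ denotes $\mathrm{tr}$ with $x_m$ specialized to $\mathrm{x}_m$, where $X_S=\{\mathrm{x}_1,\dots,\mathrm{x}_{d-1}\}$ is the solution attached to $S$. One has $E=\mathrm{tr}_S(e_i)=\frac1d\sum_{s=0}^{d-1}\mathrm{x}_s\mathrm{x}_{d-s}=1/|S|$.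 Invariants: let $B_n$ be the braid group with generators $\sigma_1,\dots,\sigma_{n-1}$, $\widehat\alpha$ the closure of the braid $\alpha$, $\epsilon(\alpha)$ the sum of the exponents of the generators in a braid word for $\alpha$, $\pi:\mathbb{C}B_n\to\mathcal{H}_n(q)$, $\sigma_i\mapsto G_i$, and $\delta:\mathbb{C}B_n\to\mathrm{Y}_{d,n}(u)$, $\sigma_i\mapsto g_i$, the natural algebra homomorphisms. Put $D_{\mathcal H}:=\frac{1}{\zeta\sqrt{\lambda_{\mathcal H}}}$ and $D_{\mathrm Y}:=\frac{1}{z\sqrt{\lambda_{\mathrm Y}}}$. For $\alpha\in B_n$, $P(\widehat\alpha):=D_{\mathcal H}^{\,n-1}(\sqrt{\lambda_{\mathcal H}})^{\epsilon(\alpha)}\,\tau(\pi(\alpha))$ and $\Delta_S(\widehat\alpha):=D_{\mathrm Y}^{\,n-1}(\sqrt{\lambda_{\mathrm Y}})^{\epsilon(\alpha)}\,\mathrm{tr}_S(\delta(\alpha))$. These are well-defined on isotopy classes of oriented links ($P$ is the HOMFLYPT polynomial). Square roots are chosen compatibly: if $\zeta^2\lambda_{\mathcal H}=z^2\lambda_{\mathrm Y}$, they are chosen so that $\zeta\sqrt{\lambda_{\mathcal H}}=z\sqrt{\lambda_{\mathrm Y}}$. *)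

(* Defs.v *)
From HB Require Import structures.
From mathcomp Require Import all_boot all_order all_algebra.
From mathcomp Require Import perm ring lra boolp reals trigo complex.

Set Implicit Arguments.
Unset Strict Implicit.
Unset Printing Implicit Defensive.

Import Order.TTheory GRing.Theory Num.Theory.

Local Open Scope ring_scope.
Local Open Scope quotient_scope.

(* Associative unital algebras given by generators and relations: terms    *)
(* modulo the least congruence containing the algebra axioms and the given *)
(* relations r.                                                            *)
Inductive aterm (K X : Type) : Type :=
| Tgen of X
| Tcst of K
| Tadd of aterm K X & aterm K X
| Tmul of aterm K X & aterm K X.

Arguments Tgen {K X}.
Arguments Tcst {K X}.

Declare Scope aterm_scope.
Delimit Scope aterm_scope with AT.
Bind Scope aterm_scope with aterm.
Notation "x + y" := (Tadd x y) : aterm_scope.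
Notation "x * y" := (Tmul x y) : aterm_scope.
Notation "x ^+ n" := (iter n (Tmul x) (Tcst 1%R)) : aterm_scope.

HB.instance Definition _ (K X : Type) := gen_eqMixin (aterm K X).
HB.instance Definition _ (K X : Type) := gen_choiceMixin (aterm K X).

Section PresentedAlgebra.
Variables (K : fieldType) (X : Type) (r : aterm K X -> aterm K X -> Prop).
Implicit Types (s t v : aterm K X) (c k : K).

Inductive tcong : aterm K X -> aterm K X -> Prop :=
| tcong_rel s t : r s t -> tcong s t
| tcong_refl t : tcong t t
| tcong_sym s t : tcong s t -> tcong t s
| tcong_trans s t v : tcong s t -> tcong t v -> tcong s v
| tcong_add s s' t t' : tcong s s' -> tcong t t' -> tcong (s + t) (s' + t')
| tcong_mul s s' t t' : tcong s s' -> tcong t t' -> tcong (s * t) (s' * t')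
| tcong_addA s t v : tcong (s + (t + v)) (s + t + v)
| tcong_addC s t : tcong (s + t) (t + s)
| tcong_add0 t : tcong (Tcst 0 + t) t
| tcong_mulA s t v : tcong (s * (t * v)) (s * t * v)
| tcong_mul1l t : tcong (Tcst 1 * t) t
| tcong_mul0l t : tcong (Tcst 0 * t) (Tcst 0)
| tcong_mulDl s t v : tcong ((s + t) * v) (s * v + t * v)
| tcong_mulDr s t v : tcong (s * (t + v)) (s * t + s * v)
| tcong_cstD c k : tcong (Tcst (c + k)%R) (Tcst c + Tcst k)
| tcong_cstM c k : tcong (Tcst (c * k)%R) (Tcst c * Tcst k)
| tcong_cstC c t : tcong (Tcst c * t) (t * Tcst c).

Definition tcongb s t : bool := `[< tcong s t >].

Lemma tcongb_refl : reflexive tcongb.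
Proof. by move=> t; apply/asboolP/tcong_refl. Qed.

Lemma tcongb_sym : symmetric tcongb.
Proof. by move=> s t; apply/asboolP/asboolP; apply: tcong_sym. Qed.

Lemma tcongb_trans : transitive tcongb.
Proof.
by move=> t s v /asboolP st /asboolP tv; apply/asboolP/(tcong_trans st tv).
Qed.

Canonical tcong_equiv := EquivRel tcongb tcongb_refl tcongb_sym tcongb_trans.

Definition palg : Type := {eq_quot tcong_equiv}.
HB.instance Definition _ := Choice.on palg.

Definition palg_of (t : aterm K X) : palg := \pi_({eq_quot tcong_equiv}) t.
Definition palg_repr (a : palg) : aterm K X :=
  repr (a : {eq_quot tcong_equiv}).

Lemma palg_ofP s t : tcong s t <-> palg_of s = palg_of t.
Proof.
split=> [st|]; first by apply/(@eqmodP _ tcong_equiv)/asboolP.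
by move/(@eqmodP _ tcong_equiv)/asboolP.
Qed.

Lemma palg_reprK a : palg_of (palg_repr a) = a.
Proof. exact: reprK. Qed.

Lemma palg_repr_of t : tcong (palg_repr (palg_of t)) t.
Proof. by apply/palg_ofP; rewrite palg_reprK. Qed.

Let add (a b : palg) : palg := palg_of (palg_repr a + palg_repr b).
Let mul (a b : palg) : palg := palg_of (palg_repr a * palg_repr b).
Let scale c (a : palg) : palg := palg_of (Tcst c * palg_repr a).

Let addE s t : add (palg_of s) (palg_of t) = palg_of (s + t).
Proof. by apply/palg_ofP/tcong_add; apply: palg_repr_of. Qed.

Let mulE s t : mul (palg_of s) (palg_of t) = palg_of (s * t).
Proof. by apply/palg_ofP/tcong_mul; apply: palg_repr_of. Qed.

Let scaleE c t : scale c (palg_of t) = palg_of (Tcst c * t).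
Proof.
by apply/palg_ofP/tcong_mul; [apply: tcong_refl|apply: palg_repr_of].
Qed.

Lemma palg_ind (P : palg -> Prop) :
  (forall t, P (palg_of t)) -> forall a, P a.
Proof. by move=> Pt a; rewrite -(palg_reprK a). Qed.

Let addA : associative add.
Proof.
elim/palg_ind=> s; elim/palg_ind=> t; elim/palg_ind=> v.
by rewrite !addE; apply/palg_ofP/tcong_addA.
Qed.

Let addC : commutative add.
Proof.
elim/palg_ind=> s; elim/palg_ind=> t.
by rewrite !addE; apply/palg_ofP/tcong_addC.
Qed.

Let add0 : left_id (palg_of (Tcst 0)) add.
Proof. by elim/palg_ind=> t; rewrite addE; apply/palg_ofP/tcong_add0. Qed.

Let addN : left_inverse (palg_of (Tcst 0)) (scale (-1)) add.
Proof.
elim/palg_ind=> t; rewrite scaleE addE; apply/palg_ofP.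
apply: (@tcong_trans _ (Tcst (-1) * t + Tcst 1 * t)%AT).
  by apply: tcong_add; [apply: tcong_refl|apply/tcong_sym/tcong_mul1l].
apply: (@tcong_trans _ ((Tcst (-1) + Tcst 1) * t)%AT).
  exact/tcong_sym/tcong_mulDl.
apply: (@tcong_trans _ (Tcst 0 * t)%AT); last exact: tcong_mul0l.
apply: tcong_mul; last exact: tcong_refl.
by have := tcong_cstD (-1) 1; rewrite addNr => /tcong_sym.
Qed.

HB.instance Definition _ := GRing.isZmodule.Build palg addA addC add0 addN.

Let addrE s t : palg_of s + palg_of t = palg_of (s + t)%AT.
Proof. exact: addE. Qed.

Let mulA : associative mul.
Proof.
elim/palg_ind=> s; elim/palg_ind=> t; elim/palg_ind=> v.
by rewrite !mulE; apply/palg_ofP/tcong_mulA.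
Qed.

Let mul1l : left_id (palg_of (Tcst 1)) mul.
Proof. by elim/palg_ind=> t; rewrite mulE; apply/palg_ofP/tcong_mul1l. Qed.

Let mul1r : right_id (palg_of (Tcst 1)) mul.
Proof.
elim/palg_ind=> t; rewrite mulE; apply/palg_ofP.
exact: tcong_trans (tcong_sym (tcong_cstC _ _)) (tcong_mul1l _).
Qed.

Let mulDl : left_distributive mul +%R.
Proof.
elim/palg_ind=> s; elim/palg_ind=> t; elim/palg_ind=> v.
by rewrite (addrE s t) !mulE addrE; apply/palg_ofP/tcong_mulDl.
Qed.

Let mulDr : right_distributive mul +%R.
Proof.
elim/palg_ind=> s; elim/palg_ind=> t; elim/palg_ind=> v.
by rewrite (addrE t v) !mulE addrE; apply/palg_ofP/tcong_mulDr.
Qed.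

HB.instance Definition _ :=
  GRing.Zmodule_isPzRing.Build palg mulA mul1l mul1r mulDl mulDr.

Let scaleA c k (a : palg) : scale c (scale k a) = scale (c * k) a.
Proof.
elim/palg_ind: a => t; rewrite !scaleE; apply/palg_ofP.
apply: tcong_trans (tcong_mulA _ _ _) _.
by apply: tcong_mul; [apply/tcong_sym/tcong_cstM|apply: tcong_refl].
Qed.

Let scale1 : left_id 1 scale.
Proof. by elim/palg_ind=> t; rewrite scaleE; apply/palg_ofP/tcong_mul1l. Qed.

Let scaleDr : right_distributive scale +%R.
Proof.
move=> c; elim/palg_ind=> s; elim/palg_ind=> t.
by rewrite (addrE s t) !scaleE addrE; apply/palg_ofP/tcong_mulDr.
Qed.

Let scaleDl (a : palg) : {morph scale^~ a : c k / c + k}.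
Proof.
elim/palg_ind: a => t c k; rewrite !scaleE addrE.
apply/palg_ofP; apply: tcong_trans (tcong_mulDl _ _ _).
by apply: tcong_mul; [apply: tcong_cstD|apply: tcong_refl].
Qed.

HB.instance Definition _ :=
  GRing.Zmodule_isLmodule.Build K palg scaleA scale1 scaleDr scaleDl.

Lemma palg_ofD s t : palg_of (s + t) = palg_of s + palg_of t.
Proof. by rewrite -addE. Qed.

Lemma palg_ofM s t : palg_of (s * t) = palg_of s * palg_of t.
Proof. by rewrite -mulE. Qed.

Lemma palg_ofZ c t : palg_of (Tcst c * t) = c *: palg_of t.
Proof. by rewrite -scaleE. Qed.

Lemma palg_of1 : palg_of (Tcst 1) = 1.
Proof. by []. Qed.

Lemma palg_of0 : palg_of (Tcst 0) = 0.
Proof. by []. Qed.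

Lemma palg_ofX t n : palg_of (t ^+ n) = palg_of t ^+ n.
Proof. by elim: n => // n IHn; rewrite /= palg_ofM IHn exprS. Qed.

Lemma palg_of_cst c : palg_of (Tcst c) = c *: (1 : palg).
Proof.
by rewrite -palg_of1 -palg_ofZ -[in LHS](mulr1 c); apply/palg_ofP/tcong_cstM.
Qed.

Lemma palg_scalerAl c (a b : palg) : c *: (a * b) = (c *: a) * b.
Proof.
elim/palg_ind: a => s; elim/palg_ind: b => t.
by rewrite -palg_ofM -!palg_ofZ -palg_ofM; apply/palg_ofP/tcong_mulA.
Qed.

Lemma palg_scalerAr c (a b : palg) : c *: (a * b) = a * (c *: b).
Proof.
have cE (a' : palg) : c *: a' = a' * (c *: (1 : palg)).
  elim/palg_ind: a' => t; rewrite -palg_of_cst -palg_ofZ -palg_ofM.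
  exact/palg_ofP/tcong_cstC.
by rewrite (cE (a * b)) (cE b) mulrA.
Qed.

End PresentedAlgebra.

Section PresentedAlgebraLift.
Variables (K : fieldType) (X : Type) (r : aterm K X -> aterm K X -> Prop).
Variables (A : algType K) (f : X -> A).

Fixpoint term_eval (t : aterm K X) : A :=
  match t with
  | Tgen x => f x
  | Tcst c => c%:A
  | Tadd s t => term_eval s + term_eval t
  | Tmul s t => term_eval s * term_eval t
  end.

Definition palg_lift (a : palg r) : A := term_eval (palg_repr a).

Hypothesis fr : forall s t, r s t -> term_eval s = term_eval t.

Lemma tcong_eval s t : tcong r s t -> term_eval s = term_eval t.
Proof.
elim=> //=.
- by move=> {}s {}t v _ -> _ ->.
- by move=> ? ? ? ? _ -> _ ->.
- by move=> ? ? ? ? _ -> _ ->.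
- by move=> *; rewrite addrA.
- by move=> *; rewrite addrC.
- by move=> *; rewrite scale0r add0r.
- by move=> *; rewrite mulrA.
- by move=> *; rewrite scale1r mul1r.
- by move=> *; rewrite scale0r mul0r.
- by move=> *; rewrite mulrDl.
- by move=> *; rewrite mulrDr.
- by move=> *; rewrite scalerDl.
- by move=> *; rewrite -scalerAl mul1r scalerA.
- by move=> *; rewrite -scalerAl -scalerAr mul1r mulr1.
Qed.

Lemma palg_liftE t : palg_lift (palg_of r t) = term_eval t.
Proof. exact/tcong_eval/palg_repr_of. Qed.

Lemma palg_lift_linear : linear palg_lift.
Proof.
move=> c; elim/palg_ind=> s; elim/palg_ind=> t.
by rewrite -palg_ofZ -palg_ofD !palg_liftE /= -scalerAl mul1r.
Qed.

Lemma palg_lift_monoid : monoid_morphism palg_lift.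
Proof.
split=> [|]; first by rewrite -palg_of1 palg_liftE /= scale1r.
by elim/palg_ind=> s; elim/palg_ind=> t; rewrite -palg_ofM !palg_liftE.
Qed.

End PresentedAlgebraLift.

Lemma term_evalX (K : fieldType) (X : Type) (A : algType K) (f : X -> A) t n :
  term_eval f (t ^+ n)%AT = term_eval f t ^+ n.
Proof. by elim: n => [|n IHn] /=; rewrite ?scale1r // IHn exprS. Qed.

(* Indices are 0-based: i : 'I_n.-1 stands for the generator of index i+1. *)
Inductive hecke_rel (K : fieldType) (q : K) (n : nat) :
    aterm K 'I_n.-1 -> aterm K 'I_n.-1 -> Prop :=
| hecke_comm (i j : 'I_n.-1) : (i.+1 < j)%N || (j.+1 < i)%N ->
    hecke_rel q (Tgen i * Tgen j) (Tgen j * Tgen i)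
| hecke_braid (i j : 'I_n.-1) : j = i.+1 :> nat ->
    hecke_rel q (Tgen j * Tgen i * Tgen j) (Tgen i * Tgen j * Tgen i)
| hecke_quad (i : 'I_n.-1) :
    hecke_rel q (Tgen i ^+ 2) (Tcst (q - 1)%R * Tgen i + Tcst q).

Definition hecke (K : fieldType) (q : K) (n : nat) : Type :=
  palg (@hecke_rel K q n).

Section Hecke.
Variables (K : fieldType) (q : K).
Implicit Type n : nat.

HB.instance Definition _ n := GRing.PzRing.on (hecke q n).
HB.instance Definition _ n := GRing.Lmodule.on (hecke q n).

Definition hG n (i : 'I_n.-1) : hecke q n :=
  palg_of (@hecke_rel K q n) (Tgen i).

Lemma hecke_nonzero n : 1 != 0 :> hecke q n.
Proof.
pose f := fun _ : 'I_n.-1 => - 1 : K^o.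
have fr s t : @hecke_rel K q n s t -> term_eval f s = term_eval f t.
  case=> // i; rewrite term_evalX /= /f /GRing.scale /= expr2.
  by rewrite !mulr1 mulrNN mulr1 mulrN1 opprB subrK.
apply/eqP => /(congr1 (palg_lift f)).
rewrite -palg_of1 -palg_of0 !palg_liftE //= scale1r scale0r.
by move/eqP; rewrite oner_eq0.
Qed.

HB.instance Definition _ n :=
  GRing.PzSemiRing_isNonZero.Build (hecke q n) (@hecke_nonzero n).
HB.instance Definition _ n :=
  GRing.Lmodule_isLalgebra.Build K (hecke q n) (@palg_scalerAl K _ _).
HB.instance Definition _ n :=
  GRing.Lalgebra_isAlgebra.Build K (hecke q n) (@palg_scalerAr K _ _).

Lemma hG_comm n (i j : 'I_n.-1) : (i.+1 < j)%N || (j.+1 < i)%N ->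
  hG i * hG j = hG j * hG i.
Proof.
by move=> ij; have /palg_ofP := tcong_rel (hecke_comm q ij); rewrite !palg_ofM.
Qed.

Lemma hG_braid n (i j : 'I_n.-1) : j = i.+1 :> nat ->
  hG j * hG i * hG j = hG i * hG j * hG i.
Proof.
by move=> ij; have /palg_ofP := tcong_rel (hecke_braid q ij); rewrite !palg_ofM.
Qed.

Lemma hG_quad n (i : 'I_n.-1) : hG i ^+ 2 = (q - 1) *: hG i + q%:A.
Proof.
have /palg_ofP := tcong_rel (hecke_quad q i).
by rewrite palg_ofX palg_ofD palg_ofZ palg_of_cst.
Qed.

(* The natural map from H_n to H_(n+1), sending G_i to G_i. *)
Definition hecke_incl n : hecke q n -> hecke q n.+1 :=
  palg_lift (fun i : 'I_n.-1 => hG (widen_ord (leq_pred n) i : 'I_n.+1.-1)).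

Lemma hecke_incl_rel n s t : @hecke_rel K q n s t ->
  let f i := hG (widen_ord (leq_pred n) i : 'I_n.+1.-1) in
  term_eval f s = term_eval f t.
Proof.
case=> [i j ij|i j ij|i] f.
- exact: hG_comm.
- exact: hG_braid.
- by rewrite term_evalX /= hG_quad -scalerAl mul1r.
Qed.

HB.instance Definition _ n := GRing.isLinear.Build K (hecke q n) (hecke q n.+1)
  *:%R (@hecke_incl n) (palg_lift_linear (@hecke_incl_rel n)).
HB.instance Definition _ n :=
  GRing.isMonoidMorphism.Build (hecke q n) (hecke q n.+1)
    (@hecke_incl n) (palg_lift_monoid (@hecke_incl_rel n)).

Lemma hecke_inclG n (i : 'I_n.-1) :
  hecke_incl (hG i) = hG (widen_ord (leq_pred n) i : 'I_n.+1.-1).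
Proof. exact: (palg_liftE (@hecke_incl_rel n)). Qed.

Definition hG_inv n (i : 'I_n.-1) : hecke q n := q^-1 *: (hG i - (q - 1)%:A).

Lemma hG_mulV n (i : 'I_n.-1) : q != 0 -> hG i * hG_inv i = 1.
Proof.
move=> q0; rewrite -scalerAr mulrBr -scalerAr mulr1 -expr2 hG_quad.
by rewrite addrAC subrr add0r scalerA mulVf // scale1r.
Qed.

Lemma hG_mulVl n (i : 'I_n.-1) : q != 0 -> hG_inv i * hG i = 1.
Proof.
move=> q0; rewrite -scalerAl mulrBl -scalerAl mul1r -expr2 hG_quad.
by rewrite addrAC subrr add0r scalerA mulVf // scale1r.
Qed.

(* A linear map on the union of the H_n is given by its restrictions to the *)
(* H_n, which are compatible with the inclusions.                          *)
Definition Ocneanu_trace (zeta : K) (tau : forall n, {scalar hecke q n}) :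
    Prop :=
  [/\ forall n (h : hecke q n), tau n.+1 (hecke_incl h) = tau n h,
      forall n (h h' : hecke q n), tau n (h * h') = tau n (h' * h),
      forall n, tau n 1 = 1
    & forall n (h : hecke q n.+1),
        tau n.+2 (hecke_incl h * hG (ord_max : 'I_n.+2.-1))
        = zeta * tau n.+1 h].

End Hecke.

(* The strands i and i+1 on which the generator of index i acts. *)
Lemma ord_hi_subproof n (i : 'I_n.-1) : (i.+1 < n)%N.
Proof. by rewrite -ltn_predRL. Qed.

Definition ord_lo n (i : 'I_n.-1) : 'I_n := widen_ord (leq_pred n) i.
Definition ord_hi n (i : 'I_n.-1) : 'I_n := Ordinal (ord_hi_subproof i).

Section YokonumaTerms.
Variables (K : fieldType) (d : nat) (n : nat).

Definition Tg (i : 'I_n.-1) : aterm K ('I_n.-1 + 'I_n) := Tgen (inl i).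
Definition Tt (j : 'I_n) : aterm K ('I_n.-1 + 'I_n) := Tgen (inr j).

(* As t_(i+1) ^ d = 1, the inverse power t_(i+1) ^ (-s) is t_(i+1) ^ (d-s). *)
Definition Te (i : 'I_n.-1) : aterm K ('I_n.-1 + 'I_n) :=
  (Tcst (d%:R^-1)%R *
   \big[@Tadd K ('I_n.-1 + 'I_n)/Tcst 0%R]_(s < d)
      (Tt (ord_lo i) ^+ s * Tt (ord_hi i) ^+ (d - s)%N))%AT.

End YokonumaTerms.

Arguments Tg {K n}.
Arguments Tt {K n}.
Arguments Te {K} d {n}.

Inductive yokonuma_rel (K : fieldType) (d : nat) (u : K) (n : nat) :
    aterm K ('I_n.-1 + 'I_n) -> aterm K ('I_n.-1 + 'I_n) -> Prop :=
| yokonuma_comm (i j : 'I_n.-1) : (i.+1 < j)%N || (j.+1 < i)%N ->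
    yokonuma_rel d u (Tg i * Tg j) (Tg j * Tg i)
| yokonuma_braid (i j : 'I_n.-1) : (j == i.+1 :> nat) || (i == j.+1 :> nat) ->
    yokonuma_rel d u (Tg i * Tg j * Tg i) (Tg j * Tg i * Tg j)
| yokonuma_tt (i j : 'I_n) :
    yokonuma_rel d u (Tt i * Tt j) (Tt j * Tt i)
| yokonuma_tg (i : 'I_n.-1) (j : 'I_n) :
    yokonuma_rel d u (Tt j * Tg i) (Tg i * Tt (tperm (ord_lo i) (ord_hi i) j))
| yokonuma_td (j : 'I_n) :
    yokonuma_rel d u (Tt j ^+ d) (Tcst 1%R)
| yokonuma_quad (i : 'I_n.-1) :
    yokonuma_rel d u (Tg i ^+ 2)
      (Tcst 1%R + Tcst (u - 1)%R * Te d i + Tcst (u - 1)%R * (Te d i * Tg i)).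

Definition yokonuma (K : fieldType) (d : nat) (u : K) (n : nat) : Type :=
  palg (@yokonuma_rel K d u n).

Lemma term_eval_Te (K : fieldType) d n (A : algType K)
    (f : 'I_n.-1 + 'I_n -> A) (i : 'I_n.-1) :
  term_eval f (Te d i) = d%:R^-1 *:
    \sum_(s < d) f (inr (ord_lo i)) ^+ s * f (inr (ord_hi i)) ^+ (d - s).
Proof.
rewrite /= -scalerAl mul1r; congr (_ *: _).
rewrite (big_morph (term_eval f) (id1 := 0) (op1 := +%R)) //=.
  by apply: eq_bigr => s _; rewrite /= !term_evalX.
exact: scale0r.
Qed.

Section Yokonuma.
Variables (K : fieldType) (d : nat) (u : K).
Implicit Type n : nat.

HB.instance Definition _ n := GRing.PzRing.on (yokonuma d u n).
HB.instance Definition _ n := GRing.Lmodule.on (yokonuma d u n).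

Definition yg n (i : 'I_n.-1) : yokonuma d u n :=
  palg_of (@yokonuma_rel K d u n) (Tg i).
Definition yt n (j : 'I_n) : yokonuma d u n :=
  palg_of (@yokonuma_rel K d u n) (Tt j).

Definition ye n (i : 'I_n.-1) : yokonuma d u n :=
  d%:R^-1 *: \sum_(s < d) yt (ord_lo i) ^+ s * yt (ord_hi i) ^+ (d - s).

Lemma yokonuma_nonzero n : 1 != 0 :> yokonuma d u n.
Proof.
pose f := fun x : 'I_n.-1 + 'I_n => if x is inl _ then - 1 else 1 : K^o.
have fr s t : @yokonuma_rel K d u n s t -> term_eval f s = term_eval f t.
  case=> [? ? _|? ? _|? ?|? ?|?|?] //.
  - by rewrite /= mulrC.
  - by rewrite term_evalX /f /= expr1n scale1r.
  - rewrite term_evalX; move: (Te _ _) => e; rewrite /= /f /GRing.scale /=.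
    by rewrite !mulr1 mulrN1 mulrN addrK sqrrN expr1n.
apply/eqP => /(congr1 (palg_lift f)).
rewrite -palg_of1 -palg_of0 !palg_liftE //= scale1r scale0r.
by move/eqP; rewrite oner_eq0.
Qed.

HB.instance Definition _ n :=
  GRing.PzSemiRing_isNonZero.Build (yokonuma d u n) (@yokonuma_nonzero n).
HB.instance Definition _ n :=
  GRing.Lmodule_isLalgebra.Build K (yokonuma d u n) (@palg_scalerAl K _ _).
HB.instance Definition _ n :=
  GRing.Lalgebra_isAlgebra.Build K (yokonuma d u n) (@palg_scalerAr K _ _).

Lemma palg_of_Te n (i : 'I_n.-1) :
  palg_of (@yokonuma_rel K d u n) (Te d i) = ye i.
Proof.
rewrite palg_ofZ; congr (_ *: _).
rewrite (big_morph (palg_of (@yokonuma_rel K d u n)) (id1 := 0) (op1 := +%R)).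
- by apply: eq_bigr => s _; rewrite palg_ofM !palg_ofX.
- exact: palg_ofD.
- by [].
Qed.

Lemma yg_comm n (i j : 'I_n.-1) : (i.+1 < j)%N || (j.+1 < i)%N ->
  yg i * yg j = yg j * yg i.
Proof.
by move=> ij; have /palg_ofP := tcong_rel (yokonuma_comm d u ij);
   rewrite !palg_ofM.
Qed.

Lemma yg_braid n (i j : 'I_n.-1) : (j == i.+1 :> nat) || (i == j.+1 :> nat) ->
  yg i * yg j * yg i = yg j * yg i * yg j.
Proof.
by move=> ij; have /palg_ofP := tcong_rel (yokonuma_braid d u ij);
   rewrite !palg_ofM.
Qed.

Lemma yt_comm n (i j : 'I_n) : yt i * yt j = yt j * yt i.
Proof.
by have /palg_ofP := tcong_rel (yokonuma_tt d u i j); rewrite !palg_ofM.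
Qed.

Lemma yt_yg n (i : 'I_n.-1) (j : 'I_n) :
  yt j * yg i = yg i * yt (tperm (ord_lo i) (ord_hi i) j).
Proof.
by have /palg_ofP := tcong_rel (yokonuma_tg d u i j); rewrite !palg_ofM.
Qed.

Lemma yt_expd n (j : 'I_n) : yt j ^+ d = 1.
Proof.
by have /palg_ofP := tcong_rel (yokonuma_td d u j); rewrite palg_ofX.
Qed.

Lemma yg_quad n (i : 'I_n.-1) :
  yg i ^+ 2 = 1 + (u - 1) *: ye i + (u - 1) *: (ye i * yg i).
Proof.
have /palg_ofP := tcong_rel (yokonuma_quad d u i).
rewrite -palg_of_Te; move: (Te d i) => e.
by rewrite palg_ofX !palg_ofD !palg_ofZ palg_ofM.
Qed.

(* The natural map from Y_(d,n) to Y_(d,n+1), g_i to g_i and t_j to t_j. *)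
Definition yokonuma_incl_gen n (x : 'I_n.-1 + 'I_n) : yokonuma d u n.+1 :=
  match x with
  | inl i => yg (widen_ord (leq_pred n) i : 'I_n.+1.-1)
  | inr j => yt (widen_ord (leqnSn n) j)
  end.

Definition yokonuma_incl n : yokonuma d u n -> yokonuma d u n.+1 :=
  palg_lift (@yokonuma_incl_gen n).

Lemma yokonuma_incl_rel n s t : @yokonuma_rel K d u n s t ->
  term_eval (@yokonuma_incl_gen n) s = term_eval (@yokonuma_incl_gen n) t.
Proof.
case=> [i j ij|i j ij|i j|i j|j|i].
- exact: yg_comm.
- exact: yg_braid.
- exact: yt_comm.
- rewrite /= yt_yg; congr (_ * yt _).
  rewrite !permE /=; do !rewrite -val_eqE /=.
  by case: ifP => _; [|case: ifP => _]; apply/val_inj.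
- by rewrite term_evalX /= yt_expd scale1r.
- have eE : term_eval (@yokonuma_incl_gen n) (Te d i)
      = ye (widen_ord (leq_pred n) i : 'I_n.+1.-1).
    rewrite term_eval_Te; congr (_ *: _); apply: eq_bigr => s' _ /=.
    by congr (yt _ ^+ _ * yt _ ^+ _); apply/val_inj.
  move: (Te d i) eE => e eE.
  by rewrite term_evalX /= yg_quad eE scale1r -!scalerAl !mul1r.
Qed.

HB.instance Definition _ n :=
  GRing.isLinear.Build K (yokonuma d u n) (yokonuma d u n.+1)
    *:%R (@yokonuma_incl n) (palg_lift_linear (@yokonuma_incl_rel n)).
HB.instance Definition _ n :=
  GRing.isMonoidMorphism.Build (yokonuma d u n) (yokonuma d u n.+1)
    (@yokonuma_incl n) (palg_lift_monoid (@yokonuma_incl_rel n)).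

Lemma yokonuma_inclg n (i : 'I_n.-1) :
  yokonuma_incl (yg i) = yg (widen_ord (leq_pred n) i : 'I_n.+1.-1).
Proof. exact: (palg_liftE (@yokonuma_incl_rel n)). Qed.

Lemma yokonuma_inclt n (j : 'I_n) :
  yokonuma_incl (yt j) = yt (widen_ord (leqnSn n) j).
Proof. exact: (palg_liftE (@yokonuma_incl_rel n)). Qed.

Definition Juyumaya_trace (z : K) (x : nat -> K)
    (tr : forall n, {scalar yokonuma d u n}) : Prop :=
  [/\ forall n (a : yokonuma d u n), tr n.+1 (yokonuma_incl a) = tr n a,
      forall n (a b : yokonuma d u n), tr n (a * b) = tr n (b * a),
      forall n, tr n 1 = 1,
      forall n (a : yokonuma d u n.+1),
        tr n.+2 (yokonuma_incl a * yg (ord_max : 'I_n.+2.-1)) = z * tr n.+1 a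
    & forall n (a : yokonuma d u n) (m : nat), (1 <= m <= d.-1)%N ->
        tr n.+1 (yokonuma_incl a * yt (ord_max : 'I_n.+1) ^+ m)
        = x m * tr n a].

End Yokonuma.

Lemma sum_ord_shift (V : nmodType) (F : nat -> V) m :
  F 0 = F m -> \sum_(s < m) F s.+1 = \sum_(s < m) F s.
Proof.
case: m => [|m] F0m; first by rewrite !big_ord0.
by rewrite big_ord_recr big_ord_recl /= F0m addrC.
Qed.

Section YokonumaInverse.
Variables (K : fieldType) (d : nat) (u : K).
Hypothesis d_neq0 : d%:R != 0 :> K.

Lemma yt_expdB n (j : 'I_n) s : (s <= d)%N ->
  yt d u j ^+ (d - s) = (yt d u j ^+ d.-1) ^+ s.
Proof.
move=> sd; rewrite -exprM; case: s sd => [|s] sd.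
  by rewrite subn0 muln0 yt_expd.
have d0 : (0 < d)%N by apply: leq_trans sd.
rewrite -[RHS]mul1r -(expr1n _ s.+1) -(yt_expd d u j).
have -> : (d.-1 * s.+1 = d * s + (d - s.+1))%N.
  by rewrite -(prednK d0) /= mulnS mulSn subSS addnAC subnKC // -ltnS prednK.
by rewrite exprD exprM !yt_expd !expr1n !mul1r.
Qed.

Lemma ye_idem n (i : 'I_n.-1) : ye d u i * ye d u i = ye d u i.
Proof.
pose a := yt d u (ord_lo i); pose b := yt d u (ord_hi i) ^+ d.-1.
have ab : GRing.comm a b by apply/commrX/yt_comm.
have eE : ye d u i = d%:R^-1 *: \sum_(s < d) (a * b) ^+ s.
  congr (_ *: _); apply: eq_bigr => s _.
  by rewrite exprMn_comm // yt_expdB // ltnW.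
have abd : (a * b) ^+ d = 1.
  by rewrite exprMn_comm // yt_expd mul1r exprAC yt_expd expr1n.
have abe : (a * b) * ye d u i = ye d u i.
  rewrite eE -scalerAr; congr (_ *: _); rewrite mulr_sumr.
  rewrite -(@sum_ord_shift _ (fun s => (a * b) ^+ s)) ?abd //.
  by apply: eq_bigr => s _; rewrite -exprS.
have abse s : (a * b) ^+ s * ye d u i = ye d u i.
  by elim: s => [|s IHs]; rewrite ?mul1r // exprS -mulrA IHs.
rewrite [X in X * _]eE -scalerAl mulr_suml.
under eq_bigr do rewrite abse.
by rewrite sumr_const card_ord -scaler_nat scalerA mulVf // scale1r.
Qed.

Lemma ye_yg n (i : 'I_n.-1) : ye d u i * yg d u i = yg d u i * ye d u i.
Proof.
have tg := yt_yg d u i (ord_lo i); have th := yt_yg d u i (ord_hi i).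
rewrite tpermL in tg; rewrite tpermR in th.
have tgX s : yt d u (ord_lo i) ^+ s * yg d u i
           = yg d u i * yt d u (ord_hi i) ^+ s.
  by elim: s => [|s IHs]; rewrite ?mulr1 ?mul1r // !exprS -mulrA IHs mulrA tg
     mulrA.
have thX s : yt d u (ord_hi i) ^+ s * yg d u i
           = yg d u i * yt d u (ord_lo i) ^+ s.
  by elim: s => [|s IHs]; rewrite ?mulr1 ?mul1r // !exprS -mulrA IHs mulrA th
     mulrA.
rewrite -scalerAl -scalerAr; congr (_ *: _); rewrite mulr_suml mulr_sumr.
under eq_bigr do rewrite -mulrA thX mulrA tgX -mulrA.
rewrite -!mulr_sumr; congr (_ * _).
pose F s := yt d u (ord_lo i) ^+ s * yt d u (ord_hi i) ^+ (d - s).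
have F0d : F 0 = F d by rewrite /F subn0 subnn !yt_expd mulr1.
have -> : \sum_(s < d) yt d u (ord_hi i) ^+ s * yt d u (ord_lo i) ^+ (d - s)
        = \sum_(s < d) F (d - s)%N.
  apply: eq_bigr => s _; rewrite /F subKn ?(ltnW (ltn_ord s)) //.
  exact/esym/commrX/commr_sym/commrX/yt_comm.
rewrite -/(F _) (reindex_inj rev_ord_inj) /=.
have -> : \sum_(s < d) F (d - (d - s.+1))%N = \sum_(s < d) F s.+1.
  by apply: eq_bigr => s _; rewrite subKn.
exact: sum_ord_shift.
Qed.

Definition yg_inv n (i : 'I_n.-1) : yokonuma d u n :=
  yg d u i + (u^-1 - 1) *: ye d u i + (u^-1 - 1) *: (ye d u i * yg d u i).

Lemma yg_mulV n (i : 'I_n.-1) : u != 0 -> yg d u i * yg_inv i = 1.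
Proof.
move=> u0; rewrite /yg_inv; have := yg_quad d u i; have := ye_yg i.
have := ye_idem i; move: (ye d u i) (yg d u i) => e g ee eg gg.
have kc : (u^-1 - 1) * (u - 1) = - ((u - 1) + (u^-1 - 1)).
  by field.
rewrite !mulrDr -!scalerAr mulrA -eg -mulrA -expr2 gg !mulrDr mulr1.
rewrite -!scalerAr (mulrA e e) ee !scalerDr !scalerA kc.
move: (u - 1) (u^-1 - 1) => c k; rewrite !scaleNr.
rewrite (scalerDl e c k) (scalerDl (e * g) c k).
move: (c *: e) (c *: (e * g)) (k *: (e * g)) (k *: e) => p r s t.
rewrite (addrC p t) opprD addNKr.
by rewrite -opprD -(addrA (1 + p) r s) -(addrA 1 p) addrK.
Qed.

Lemma yg_mulVl n (i : 'I_n.-1) : u != 0 -> yg_inv i * yg d u i = 1.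
Proof.
move=> u0; rewrite -(yg_mulV i u0) /yg_inv; have := ye_yg i.
move: (ye d u i) (yg d u i) => e g eg.
by rewrite !mulrDl !mulrDr -!scalerAl -!scalerAr mulrA -eg.
Qed.

End YokonumaInverse.

(* Braid words: (i, true) stands for sigma_(i+1), (i, false) for its inverse. *)
Notation braid_word n := (seq ('I_n.-1 * bool)).

Inductive bcong (n : nat) : braid_word n -> braid_word n -> Prop :=
| bcong_free (i : 'I_n.-1) (b : bool) : bcong [:: (i, b); (i, ~~ b)] [::]
| bcong_comm (i j : 'I_n.-1) : (i.+1 < j)%N || (j.+1 < i)%N ->
    bcong [:: (i, true); (j, true)] [:: (j, true); (i, true)]
| bcong_braid (i j : 'I_n.-1) : j = i.+1 :> nat ->
    bcong [:: (i, true); (j, true); (i, true)]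
          [:: (j, true); (i, true); (j, true)]
| bcong_refl w : bcong w w
| bcong_sym v w : bcong v w -> bcong w v
| bcong_trans v w x : bcong v w -> bcong w x -> bcong v x
| bcong_cat v v' w w' : bcong v v' -> bcong w w' -> bcong (v ++ w) (v' ++ w').

Section BraidGroup.
Variable n : nat.
Implicit Types v w : braid_word n.

Definition bcongb v w : bool := `[< bcong v w >].

Lemma bcongb_refl : reflexive bcongb.
Proof. by move=> w; apply/asboolP/bcong_refl. Qed.

Lemma bcongb_sym : symmetric bcongb.
Proof. by move=> v w; apply/asboolP/asboolP; apply: bcong_sym. Qed.

Lemma bcongb_trans : transitive bcongb.
Proof.
by move=> w v x /asboolP vw /asboolP wx; apply/asboolP/(bcong_trans vw wx).
Qed.

Canonical bcong_equiv := EquivRel bcongb bcongb_refl bcongb_sym bcongb_trans.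

Definition braid : Type := {eq_quot bcong_equiv}.
HB.instance Definition _ := Choice.on braid.

Definition braid_of w : braid := \pi_({eq_quot bcong_equiv}) w.
Definition word_of (a : braid) : braid_word n :=
  repr (a : {eq_quot bcong_equiv}).

Lemma braid_ofP v w : bcong v w <-> braid_of v = braid_of w.
Proof.
split=> [vw|]; first by apply/(@eqmodP _ bcong_equiv)/asboolP.
by move/(@eqmodP _ bcong_equiv)/asboolP.
Qed.

Lemma word_ofK a : braid_of (word_of a) = a.
Proof. exact: reprK. Qed.

Lemma word_of_braid_of w : bcong (word_of (braid_of w)) w.
Proof. by apply/braid_ofP; rewrite word_ofK. Qed.

Lemma braid_ind (P : braid -> Prop) :
  (forall w, P (braid_of w)) -> forall a, P a.
Proof. by move=> Pw a; rewrite -(word_ofK a). Qed.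

Definition word_inv w : braid_word n := [seq (x.1, ~~ x.2) | x <- rev w].

Lemma word_invK : involutive word_inv.
Proof.
move=> w; rewrite /word_inv -map_rev revK -map_comp map_id_in // => -[i b] _ /=.
by rewrite negbK.
Qed.

Lemma word_mulV w : bcong (w ++ word_inv w) [::].
Proof.
elim: w => [|[i b] w IHw]; first exact: bcong_refl.
rewrite /word_inv rev_cons map_rcons -cats1 -cat1s -catA (catA w) /=.
apply: bcong_trans (bcong_free i b); rewrite -[_ :: _ ++ _]cat1s.
apply: (@bcong_cat _ [:: (i, b)] [:: (i, b)]); first exact: bcong_refl.
by apply: (@bcong_cat _ _ [::]); [exact: IHw|exact: bcong_refl].
Qed.

Lemma word_inv_cong v w : bcong v w -> bcong (word_inv v) (word_inv w).
Proof.
move=> vw; have e := bcong_refl.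
apply: (@bcong_trans _ _ (word_inv v ++ (w ++ word_inv w))).
  rewrite -[X in bcong X _]cats0.
  by apply: bcong_cat (e _ _) _; apply/bcong_sym/word_mulV.
rewrite catA -[X in bcong _ X]cat0s; apply: bcong_cat (e _ _).
apply: (@bcong_trans _ _ (word_inv v ++ v)).
  by apply: bcong_cat (e _ _) (bcong_sym vw).
by rewrite -[X in _ ++ X]word_invK; apply: word_mulV.
Qed.

Let mul (a b : braid) : braid := braid_of (word_of a ++ word_of b).
Let inv (a : braid) : braid := braid_of (word_inv (word_of a)).

Let mulE v w : mul (braid_of v) (braid_of w) = braid_of (v ++ w).
Proof. by apply/braid_ofP/bcong_cat; apply: word_of_braid_of. Qed.

Let invE w : inv (braid_of w) = braid_of (word_inv w).
Proof. exact/braid_ofP/word_inv_cong/word_of_braid_of. Qed.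

Let mulA : associative mul.
Proof.
elim/braid_ind=> v; elim/braid_ind=> w; elim/braid_ind=> x.
by rewrite !mulE catA.
Qed.

Let mul1l : left_id (braid_of [::]) mul.
Proof. by elim/braid_ind=> w; rewrite mulE. Qed.

Let mul1r : right_id (braid_of [::]) mul.
Proof. by elim/braid_ind=> w; rewrite mulE cats0. Qed.

Let mulVl : left_inverse (braid_of [::]) inv mul.
Proof.
elim/braid_ind=> w; rewrite invE mulE; apply/braid_ofP.
by rewrite -[X in _ ++ X]word_invK; apply: word_mulV.
Qed.

Let mulVr : right_inverse (braid_of [::]) inv mul.
Proof. by elim/braid_ind=> w; rewrite invE mulE; apply/braid_ofP/word_mulV. Qed.

HB.instance Definition _ := isGroup.Build braid mulA mul1l mul1r mulVl mulVr.

Definition sigma (i : 'I_n.-1) : braid := braid_of [:: (i, true)].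

Lemma braid_of_cat v w : braid_of (v ++ w) = (braid_of v * braid_of w)%g.
Proof. exact/esym/mulE. Qed.

Lemma braid_of_nil : braid_of [::] = 1%g.
Proof. by []. Qed.

Lemma braid_of_inv w : braid_of (word_inv w) = (braid_of w)^-1%g.
Proof. exact/esym/invE. Qed.

Definition exponent_sum w : int := \sum_(x <- w) (if x.2 then 1 else -1).

Lemma exponent_sum_cong v w : bcong v w -> exponent_sum v = exponent_sum w.
Proof.
elim=> {v w} //.
- by move=> i []; rewrite /exponent_sum !big_cons !big_nil.
- by move=> i j _; rewrite /exponent_sum !big_cons.
- by move=> i j _; rewrite /exponent_sum !big_cons.
- by move=> ? ? ? _ -> _ ->.
- by move=> ? ? ? ? _ + _; rewrite /exponent_sum !big_cat /= => -> ->.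
Qed.

Definition epsilon (a : braid) : int := exponent_sum (word_of a).

Lemma epsilon_braid_of w : epsilon (braid_of w) = exponent_sum w.
Proof. exact/exponent_sum_cong/word_of_braid_of. Qed.

(* Images of braids under sigma_i |-> f i and sigma_i^-1 |-> f' i. *)
Definition word_eval (A : pzRingType) (f f' : 'I_n.-1 -> A) w : A :=
  \prod_(x <- w) (if x.2 then f x.1 else f' x.1).

Lemma word_eval_cong (A : pzRingType) (f f' : 'I_n.-1 -> A) :
    (forall i, f i * f' i = 1) -> (forall i, f' i * f i = 1) ->
    (forall i j : 'I_n.-1, (i.+1 < j)%N || (j.+1 < i)%N ->
       f i * f j = f j * f i) ->
    (forall i j : 'I_n.-1, j = i.+1 :> nat ->
       f i * f j * f i = f j * f i * f j) ->
  forall v w, bcong v w -> word_eval f f' v = word_eval f f' w.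
Proof.
move=> ff' f'f fC fB v w; rewrite /word_eval; elim=> {v w} //.
- by move=> i []; rewrite !big_cons !big_nil /= mulr1.
- by move=> i j /fC ij; rewrite !big_cons big_nil /= !mulr1.
- by move=> i j /fB ij; rewrite !big_cons big_nil /= !mulr1 !mulrA.
- by move=> ? ? ? _ -> _ ->.
- by move=> ? ? ? ? _ + _; rewrite !big_cat /= => -> ->.
Qed.

End BraidGroup.

Section BraidToHecke.
Variables (K : fieldType) (q : K) (n : nat).

Definition braid_hecke (a : braid n) : hecke q n :=
  word_eval (@hG K q n) (@hG_inv K q n) (word_of a).

Hypothesis q_neq0 : q != 0.

Lemma braid_heckeE w :
  braid_hecke (braid_of w) = word_eval (@hG K q n) (@hG_inv K q n) w.
Proof.
apply: word_eval_cong (word_of_braid_of w) => [i|i|i j ij|i j ij].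
- exact: hG_mulV.
- exact: hG_mulVl.
- exact: hG_comm.
- exact/esym/hG_braid.
Qed.

Lemma braid_hecke1 : braid_hecke 1%g = 1.
Proof. by rewrite -braid_of_nil braid_heckeE /word_eval big_nil. Qed.

Lemma braid_heckeM a b :
  braid_hecke (a * b)%g = braid_hecke a * braid_hecke b.
Proof.
elim/braid_ind: a => v; elim/braid_ind: b => w.
by rewrite -braid_of_cat !braid_heckeE /word_eval big_cat.
Qed.

Lemma braid_hecke_sigma i : braid_hecke (sigma i) = hG q i.
Proof. by rewrite braid_heckeE /word_eval big_seq1. Qed.

End BraidToHecke.

Section BraidToYokonuma.
Variables (K : fieldType) (d : nat) (u : K) (n : nat).

Definition braid_yokonuma (a : braid n) : yokonuma d u n :=
  word_eval (@yg K d u n) (@yg_inv K d u n) (word_of a).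

Hypotheses (d_neq0 : d%:R != 0 :> K) (u_neq0 : u != 0).

Lemma braid_yokonumaE w :
  braid_yokonuma (braid_of w) = word_eval (@yg K d u n) (@yg_inv K d u n) w.
Proof.
apply: word_eval_cong (word_of_braid_of w) => [i|i|i j ij|i j ij].
- exact: yg_mulV.
- exact: yg_mulVl.
- exact: yg_comm.
- by apply: yg_braid; rewrite ij eqxx.
Qed.

Lemma braid_yokonuma1 : braid_yokonuma 1%g = 1.
Proof. by rewrite -braid_of_nil braid_yokonumaE /word_eval big_nil. Qed.

Lemma braid_yokonumaM a b :
  braid_yokonuma (a * b)%g = braid_yokonuma a * braid_yokonuma b.
Proof.
elim/braid_ind: a => v; elim/braid_ind: b => w.
by rewrite -braid_of_cat !braid_yokonumaE /word_eval big_cat.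
Qed.

Lemma braid_yokonuma_sigma i : braid_yokonuma (sigma i) = yg d u i.
Proof. by rewrite braid_yokonumaE /word_eval big_seq1. Qed.

End BraidToYokonuma.

(* The tuple (x_1, ..., x_(d-1)) is encoded as x : nat -> K with x 0 = 1; *)
(* only the values x m with m < d are relevant.                            *)
Definition E_system (K : fieldType) (d : nat) (x : nat -> K) : Prop :=
  x 0 = 1 /\
  forall m : nat, (1 <= m <= d.-1)%N ->
    \sum_(s < d) x ((m + s) %% d)%N * x ((d - s) %% d)%N
    = x m * \sum_(s < d) x s * x ((d - s) %% d)%N.

Section ESolutions.
Variables (R : realType) (d : nat).

Definition expi (t : R) : R[i] := Complex (cos t) (sin t).

(* The solution attached to S: x_m is the average over k in S of the m-th   *)
(* powers of the d-th roots of unity exp(2 i pi k / d).                     *)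
Definition E_solution (S : {set 'I_d}) (m : nat) : R[i] :=
  (#|S|%:R)^-1 * \sum_(k in S) expi (2 * pi * (k * m)%:R / d%:R).

Lemma expiD s t : expi (s + t) = expi s * expi t.
Proof.
by rewrite /expi cosD sinD /GRing.mul /=; congr Complex; rewrite addrC.
Qed.

Lemma expi0 : expi 0 = 1.
Proof. by rewrite /expi cos0 sin0. Qed.

Lemma expiX t m : expi (t * m%:R) = expi t ^+ m.
Proof.
elim: m => [|m IHm]; first by rewrite mulr0 expi0.
by rewrite -natr1 mulrDr mulr1 expiD IHm exprSr.
Qed.

Lemma expi_eq1 t : 0 < t < 2 * pi -> expi t != 1.
Proof.
case/andP=> t0 t2; apply/eqP => /(congr1 (@complex.Re R)) /= ct.
have s0 : 0 < sin (t / 2).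
  by apply: sin_gt0_pi; rewrite divr_gt0 //= ltr_pdivrMr // mulrC.
have := cos_mulr2n (t / 2); rewrite {1}mulr2n -splitr ct.
have := cos2Dsin2 (t / 2) => cs; move: (exprn_gt0 2 s0) => s2.
rewrite -[X in X *+ 2](addrK (sin (t / 2) ^+ 2)) cs => e; lra.
Qed.

Hypothesis d_gt0 : (0 < d)%N.

Lemma expi_root : expi (2 * pi / d%:R) ^+ d = 1.
Proof.
rewrite -expiX divfK ?pnatr_eq0 -?lt0n // /expi mulr_natl cos_mulr2n.
by rewrite cospi mulr2n sinD sinpi !mul0r !mulr0 addr0 sqrrN expr1n addrK.
Qed.

Lemma expi_prim : d.-primitive_root (expi (2 * pi / d%:R)).
Proof.
apply/andP; split=> //; apply/forallP => i.
rewrite unity_rootE; apply/eqP; case: (eqVneq i.+1 d) => [->|id].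
  by rewrite expi_root eqxx.
apply/negbTE; rewrite -expiX; apply: expi_eq1.
have dR : 0 < d%:R :> R by rewrite ltr0n.
have p0 : 0 < 2 * pi :> R by rewrite mulr_gt0 ?pi_gt0.
rewrite mulr_gt0 ?divr_gt0 //= mulrAC ltr_pdivrMr // ltr_pM2l // ltr_nat.
by rewrite ltn_neqAle id ltn_ord.
Qed.

Lemma E_solutionE (S : {set 'I_d}) m :
  E_solution S m = (#|S|%:R)^-1 * \sum_(k in S) expi (2 * pi / d%:R) ^+ (k * m).
Proof.
by congr (_ * _); apply: eq_bigr => k _; rewrite -expiX mulrAC.
Qed.

Lemma E_solution_system (S : {set 'I_d}) :
  S != set0 -> E_system d (E_solution S).
Proof.
move=> S0; set w := expi (2 * pi / d%:R); have wP := expi_prim.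
have N0 : #|S|%:R != 0 :> R[i] by rewrite pnatr_eq0 cards_eq0.
have a0 : E_solution S 0 = 1.
  rewrite E_solutionE; under eq_bigr do rewrite muln0 expr0.
  by rewrite sumr_const mulVf.
split=> // m _.
have orth (k l : 'I_d) :
    \sum_(s < d) w ^+ (k * s) * w ^+ (l * (d - s)) = (d * (k == l))%:R.
  pose v := w ^+ (k + l * d.-1).
  have vE (s : 'I_d) : w ^+ (k * s) * w ^+ (l * (d - s)) = v ^+ s.
    rewrite -exprM mulnDl exprD; congr (_ * _); apply/eqP.
    rewrite (eq_prim_root_expr wP) -mulnA -(eqn_modDr (l * s)).
    rewrite -!mulnDr subnK ?(ltnW (ltn_ord s)) // addnC -mulSn prednK //.
    by rewrite modnMl mulnCA modnMr.
  under eq_bigr do rewrite vE.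
  have vd : v ^+ d = 1 by rewrite exprAC expi_root expr1n.
  case: eqVneq => [kl|kl]; last first.
    have v1 : v - 1 != 0.
      rewrite subr_eq0 /v -(expr0 w) (eq_prim_root_expr wP) -(eqn_modDr l).
      rewrite -addnA -mulnSr prednK // add0n addnC modnMDl !modn_small //.
    rewrite muln0; apply: (mulfI v1).
    by rewrite -subrX1 vd subrr mulr0.
  have -> : v = 1.
    by rewrite /v kl -mulnS prednK // mulnC exprM expi_root expr1n.
  under eq_bigr do rewrite expr1n.
  by rewrite sumr_const card_ord muln1.
have modE m' : E_solution S (m' %% d) = E_solution S m'.
  rewrite !E_solutionE; congr (_ * _); apply: eq_bigr => k _; apply/eqP.
  by rewrite (eq_prim_root_expr wP) modnMmr.
have main m' :
    \sum_(s < d) E_solution S ((m' + s) %% d) * E_solution S ((d - s) %% d)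
    = d%:R / #|S|%:R * E_solution S m'.
  under eq_bigr do rewrite !modE !E_solutionE mulrACA big_distrlr /=.
  rewrite -mulr_sumr exchange_big /= E_solutionE -/w.
  rewrite (mulrC d%:R) -!mulrA [d%:R * _]mulrCA; congr (_ * (_ * _)).
  rewrite mulr_sumr.
  apply: eq_bigr => k kS; rewrite exchange_big /= (bigD1 k) //=.
  rewrite [X in _ + X]big1 ?addr0 => [|l /andP[_ lk]].
    under eq_bigr do rewrite mulnDr exprD -mulrA.
    by rewrite -mulr_sumr orth eqxx muln1 mulrC.
  under eq_bigr do rewrite mulnDr exprD -mulrA.
  by rewrite -mulr_sumr orth eq_sym (negbTE lk) muln0 mulr0.
have <- : \sum_(s < d) E_solution S ((0 + s) %% d)
                   * E_solution S ((d - s) %% d)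
        = \sum_(s < d) E_solution S s * E_solution S ((d - s) %% d).
  by apply: eq_bigr => s _; rewrite add0n modn_small.
by rewrite !main a0 mulr1 mulrC.
Qed.

End ESolutions.

Section Invariants.
Variable K : fieldType.

Definition lambda_H (q zeta : K) : K := (zeta + (1 - q)) / (q * zeta).
Definition lambda_Y (u z E : K) : K := (z + (1 - u) * E) / (u * z).

(* E = tr(e_i), computed at i = 1, n = 2. *)
Definition trace_E (d : nat) (u : K) (tr : forall n, {scalar yokonuma d u n}) :
    K :=
  tr 2 (ye d u (ord0 : 'I_2.-1)).

(* In both invariants s is the chosen square root of lambda, and an oriented *)
(* link is presented as the closure of a braid on n strands.                 *)
Definition HOMFLYPT (q zeta s : K) (tau : forall n, {scalar hecke q n})
    (n : nat) (alpha : braid n) : K :=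
  (1 / (zeta * s)) ^ (n%:Z - 1) * s ^ (epsilon alpha)
  * tau n (braid_hecke q alpha).

Definition Delta (d : nat) (u z s : K) (tr : forall n, {scalar yokonuma d u n})
    (n : nat) (alpha : braid n) : K :=
  (1 / (z * s)) ^ (n%:Z - 1) * s ^ (epsilon alpha)
  * tr n (braid_yokonuma d u alpha).

End Invariants.

(* Main.v *)
From HB Require Import structures.
Require Import Defs.
From mathcomp Require Import all_boot all_order all_algebra.
From mathcomp Require Import perm ring reals trigo complex.

Set Implicit Arguments.
Unset Strict Implicit.
Unset Printing Implicit Defensive.

Import Order.TTheory GRing.Theory Num.Theory.

Local Open Scope ring_scope.

(* With r = z / zeta, equality of P and Delta_S means that
   tr(delta(alpha)) = r^epsilon(alpha) tau(pi(alpha)) for all braids, i.e. that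
   for tr the elements g_i / r behave like the G_i. As tau is determined by its
   defining rules, this holds as soon as (g_i - r q) (g_i + r) lies in the
   radical of the trace form (a, b) |-> tr(a b): then the Hecke algebra maps to
   Y_(d,n) modulo the radical, and tr pulls back to an Ocneanu trace. The
   radical contains g_i^2 - (u - 1) g_i - u if u = 1 or E = 1 (in the latter
   case it contains e_i - 1), and g_i^2 - 1 if z = - E (it then contains
   e_i (1 + g_i)). In the cases (3)-(6) and (9)-(12) tau and the restriction of
   tr to braids are one-dimensional characters.

   Conversely, if P and Delta_S are proportional they agree, and
   tr(delta(alpha) (g_1 - r q) (g_1 + r)) = 0 for all alpha. The choices
   alpha = 1, s_1, s_1^2 in B_2 and s_2^2, s_2 s_1^2 s_2 in B_3 yield four
   polynomial equations whose solutions are the listed cases; B_2 alone is not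
   enough, as it also admits r = -1, q = -u, 2 z = 1 + u - (1 - u) E. *)

(** * Iwahori-Hecke algebras *)

Section PresentedAlgebraInduction.
Variables (K : fieldType) (X : Type) (r : aterm K X -> aterm K X -> Prop).

Lemma palg_gen_ind (P : palg r -> Prop) :
    (forall x, P (palg_of r (Tgen x))) -> (forall c, P (c *: (1 : palg r))) ->
    (forall a b, P a -> P b -> P (a + b)) ->
    (forall a b, P a -> P b -> P (a * b)) ->
  forall a, P a.
Proof.
move=> Pg Pc PD PM; elim/palg_ind; elim=> [x|c|s Ps t Pt|s Ps t Pt].
- exact: Pg.
- by rewrite palg_of_cst; apply: Pc.
- by rewrite palg_ofD; apply: PD.
- by rewrite palg_ofM; apply: PM.
Qed.

(** The induction proves more: [P c] implies [P (a * c)] for every c. In this form the product case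
    composes, and c = 1 gives the claim. *)
Lemma palg_left_ind (P : palg r -> Prop) :
    P 1 -> (forall c a, P a -> P (c *: a)) ->
    (forall a b, P a -> P b -> P (a + b)) ->
    (forall x a, P a -> P (palg_of r (Tgen x) * a)) ->
  forall a, P a.
Proof.
move=> P1 PZ PD PM a; rewrite -(mulr1 a).
elim/palg_gen_ind: a 1 P1 => [x|c|a b Pa Pb|a b Pa Pb] c' Pc'.
- exact: PM.
- by rewrite -palg_scalerAl mul1r; apply: PZ.
- by rewrite mulrDl; apply: PD; [apply: Pa|apply: Pb].
- by rewrite -mulrA; apply/Pa/Pb.
Qed.

End PresentedAlgebraInduction.

Section HeckeSpan.
Variables (K : fieldType) (q : K).

Lemma hecke_ind n (P : hecke q n -> Prop) :
    (forall i, P (hG q i)) -> (forall c, P c%:A) ->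
    (forall a b, P a -> P b -> P (a + b)) ->
    (forall a b, P a -> P b -> P (a * b)) ->
  forall a, P a.
Proof. exact: palg_gen_ind. Qed.

Lemma hecke_left_ind n (P : hecke q n -> Prop) :
    P 1 -> (forall c a, P a -> P (c *: a)) ->
    (forall a b, P a -> P b -> P (a + b)) ->
    (forall i a, P a -> P (hG q i * a)) ->
  forall a, P a.
Proof. exact: palg_left_ind. Qed.

(** Counting from 0, [i = n] is the last generator of H_(n+2), while the generators of H_n have
    indices below n - 1, hence are far from it. *)
Lemma hecke_incl2_comm n (i : 'I_n.+2.-1) (a : hecke q n) : i = n :> nat ->
  hG q i * hecke_incl (hecke_incl a) = hecke_incl (hecke_incl a) * hG q i.
Proof.
move=> ni; elim/hecke_ind: a => [j|c|a b IHa IHb|a b IHa IHb].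
- rewrite !hecke_inclG; apply: hG_comm; apply/orP; right.
  by rewrite /= ni -ltn_predRL ltn_ord.
- by rewrite !linearZ /= !rmorph1 -scalerAr -scalerAl mulr1 mul1r.
- by rewrite !raddfD /= mulrDl mulrDr IHa IHb.
- by rewrite !rmorphM /= mulrA IHa -!mulrA IHb.
Qed.


(** The subspace H_n + H_n G_n H_n of H_(n+1). The equation [i.+1 = n] selects G_n without assuming
    that a last generator exists, so that n = 0 is covered. *)
Inductive hecke_span n : hecke q n.+1 -> Prop :=
| hecke_span_add a b : hecke_span a -> hecke_span b -> hecke_span (a + b)
| hecke_span_incl (a : hecke q n) : hecke_span (hecke_incl a)
| hecke_span_top (a b : hecke q n) (i : 'I_n.+1.-1) : i.+1 = n ->
    hecke_span (hecke_incl a * hG q i * hecke_incl b).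

Lemma hecke_span_mull n (a : hecke q n) b :
  hecke_span b -> hecke_span (hecke_incl a * b).
Proof.
elim=> [{}b c _ IHb _ IHc|b'|b' c i ni].
- by rewrite mulrDr; apply: hecke_span_add.
- by rewrite -rmorphM; apply: hecke_span_incl.
- by rewrite !mulrA -rmorphM; apply: hecke_span_top.
Qed.

Lemma hecke_span_mulr n (a : hecke q n) b :
  hecke_span b -> hecke_span (b * hecke_incl a).
Proof.
elim=> [{}b c _ IHb _ IHc|b'|b' c i ni].
- by rewrite mulrDl; apply: hecke_span_add.
- by rewrite -rmorphM; apply: hecke_span_incl.
- by rewrite -!mulrA -rmorphM mulrA; apply: hecke_span_top.
Qed.

(** The span contains 1, so it is enough that left multiplication by each generator preserves it.
    Only the last generator G is delicate: in G a G b the induction hypothesis is used to split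
    a. *)
Lemma hecke_spanP n (a : hecke q n.+1) : hecke_span a.
Proof.
elim: n a => [|n IHn] a; elim/hecke_left_ind: a => [|c a|a b|i a].
- by rewrite -(rmorph1 (@hecke_incl K q 0)); apply: hecke_span_incl.
- by rewrite -[a in c *: a]mul1r scalerAl -(rmorph1 (@hecke_incl K q 0))
     -linearZ; apply: hecke_span_mull.
- exact: hecke_span_add.
- by case: i.
- by rewrite -(rmorph1 (@hecke_incl K q n.+1)); apply: hecke_span_incl.
- by rewrite -[a in c *: a]mul1r scalerAl -(rmorph1 (@hecke_incl K q n.+1))
     -linearZ; apply: hecke_span_mull.
- exact: hecke_span_add.
have gE (j : 'I_n.+2.-1) (nj : j = n :> nat) (b : hecke q n.+1) :
  hecke_span (hG q j * hecke_incl b).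
  by rewrite -[hG q j]mul1r -(rmorph1 (@hecke_incl K q n.+1));
     apply: hecke_span_top; rewrite nj.
case: (eqVneq (i : nat) n) => [ni|ni]; last first.
  have ltin : (i < n)%N.
    by move: (ltn_ord i); rewrite /= ltnS leq_eqVlt (negPf ni).
  have -> : i = widen_ord (leq_pred n.+1) (Ordinal ltin : 'I_n.+1.-1).
    exact/val_inj.
  by rewrite -hecke_inclG; apply: hecke_span_mull.
elim=> [{}a b _ IHa _ IHb|{}a|{}a b j nj].
- by rewrite mulrDr; apply: hecke_span_add.
- exact: gE.
have -> : j = i by case: nj => nj; apply/val_inj/(etrans nj).
rewrite !mulrA; apply: hecke_span_mulr.
elim: (IHn a) => {a b nj j}.
- move=> a b _ IHa _ IHb.
  by rewrite raddfD mulrDr mulrDl; apply: hecke_span_add.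
(* G commutes with the smaller algebra, so G a G = a G^2 and the quadratic relation applies. *)
- move=> a; rewrite (hecke_incl2_comm _ ni) -mulrA -expr2 hG_quad.
  apply: hecke_span_mull.
  have -> : (q - 1) *: hG q i + q%:A
     = hG q i * hecke_incl (q - 1)%:A + hecke_incl (q%:A : hecke q n.+1).
    by rewrite !linearZ /= !rmorph1 -scalerAr mulr1.
  by apply: hecke_span_add; [apply: gE|apply: hecke_span_incl].
(* Between the two copies of G stands one previous generator G', up to factors commuting with G;
   then G G' G = G' G G' leaves a single G. *)
- move=> a b j nj.
  rewrite !rmorphM !mulrA /= (hecke_incl2_comm _ ni) hecke_inclG -!mulrA.
  rewrite -(hecke_incl2_comm _ ni) !mulrA.
  apply: hecke_span_mulr; rewrite -!mulrA.
  apply: hecke_span_mull; rewrite !mulrA.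
  rewrite hG_braid; last by rewrite /= ni.
  by rewrite -hecke_inclG; apply: hecke_span_top; rewrite ni.
Qed.

Lemma hecke0_scalar (a : hecke q 0) : exists c, a = c%:A.
Proof.
elim/hecke_left_ind: a => [|c a [k ->]|a b [k ->] [l ->]|[]//].
- by exists 1; rewrite scale1r.
- by exists (c * k); rewrite scalerA.
- by exists (k + l); rewrite scalerDl.
Qed.

(** By cyclicity tau(a G_n b) = zeta tau(b a), so the values on the spanning set of H_(n+1) are
    dictated by those on H_n, and H_0 consists of scalars. *)
Lemma Ocneanu_trace_unique zeta (tau tau' : forall n, {scalar hecke q n}) :
    Ocneanu_trace zeta tau -> Ocneanu_trace zeta tau' ->
  forall n (h : hecke q n), tau n h = tau' n h.
Proof.
move=> [tI tC t1 tG] [t'I t'C t'1 t'G]; elim=> [h|n IHn h].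
  by have [c ->] := hecke0_scalar h; rewrite !linearZ /= t1 t'1.
elim: (hecke_spanP h) => {h} [a b _ IHa _ IHb|a|a b i ni].
- by rewrite !linearD /= IHa IHb.
- by rewrite tI t'I.
rewrite tC t'C !mulrA -!rmorphM /=.
case: n i ni IHn a b => [[]//|n] i ni IHn a b.
have -> : i = ord_max by apply/val_inj; case: ni.
by rewrite tG t'G IHn.
Qed.

End HeckeSpan.

(** * Yokonuma-Hecke algebras *)

Section YokonumaSpan.
Variables (K : fieldType) (d : nat) (u : K).
Notation Y := (yokonuma d u).
Notation yg := (@yg K d u _).
Notation yt := (@yt K d u _).
Notation ye := (@ye K d u _).
Notation incl := (@yokonuma_incl K d u _).

Lemma yokonuma_ind n (P : Y n -> Prop) :
    (forall i, P (yg i)) -> (forall j, P (yt j)) -> (forall c, P c%:A) ->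
    (forall a b, P a -> P b -> P (a + b)) ->
    (forall a b, P a -> P b -> P (a * b)) ->
  forall a, P a.
Proof. by move=> Pg Pt Pc PD PM; apply: palg_gen_ind => // -[]. Qed.

Lemma yokonuma_left_ind n (P : Y n -> Prop) :
    P 1 -> (forall c a, P a -> P (c *: a)) ->
    (forall a b, P a -> P b -> P (a + b)) ->
    (forall i a, P a -> P (yg i * a)) -> (forall j a, P a -> P (yt j * a)) ->
  forall a, P a.
Proof. by move=> P1 PZ PD Pg Pt; apply: palg_left_ind => // -[]. Qed.

(** An arbitrary morphism f allows both one inclusion and a composite of two. *)
Lemma comm_yokonuma n m (f : {lrmorphism Y n -> Y m}) (x : Y m) :
    (forall i, GRing.comm x (f (yg i))) ->
    (forall j, GRing.comm x (f (yt j))) ->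
  forall a, GRing.comm x (f a).
Proof.
move=> xg xt; elim/yokonuma_ind=> // [c|a b xa xb|a b xa xb].
- by rewrite linearZ /= rmorph1; apply: commr_sym; rewrite /GRing.comm -scalerAr
    -scalerAl mulr1 mul1r.
- by rewrite raddfD; apply: commrD.
- by rewrite rmorphM; apply: commrM.
Qed.

Lemma yt_commX n (i j : 'I_n) k l :
  yt i ^+ k * yt j ^+ l = yt j ^+ l * yt i ^+ k.
Proof. exact/commrX/commr_sym/commrX/yt_comm. Qed.

Lemma yt_incl_comm n (j : 'I_n.+1) (a : Y n) : j = n :> nat ->
  GRing.comm (yt j) (incl a).
Proof.
move=> nj; move: a; apply: comm_yokonuma => [i|k]; last first.
  by rewrite /= yokonuma_inclt; apply: yt_comm.
rewrite /GRing.comm /= yokonuma_inclg yt_yg tpermD // -val_eqE /= nj.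
  by rewrite neq_ltn (leq_trans (ltn_ord i)) // leq_pred.
by rewrite neq_ltn -ltn_predRL ltn_ord.
Qed.

Lemma yg_incl2_comm n (i : 'I_n.+2.-1) (a : Y n) : i = n :> nat ->
  GRing.comm (yg i) (incl (incl a)).
Proof.
move=> ni; move: a.
apply: (@comm_yokonuma n n.+2
         (@yokonuma_incl K d u n.+1 \o @yokonuma_incl K d u n)).
  move=> j; rewrite /= !yokonuma_inclg; apply: yg_comm; apply/orP; right.
  by rewrite /= ni -ltn_predRL ltn_ord.
move=> j; rewrite /= !yokonuma_inclt; apply: commr_sym.
rewrite /GRing.comm yt_yg tpermD // -val_eqE /= ni neq_ltn ?ltn_ord ?orbT //.
by rewrite ltnS (ltnW (ltn_ord j)) orbT.
Qed.

Lemma ytX_yg n (i : 'I_n.-1) j k :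
  yt j ^+ k * yg i = yg i * yt (tperm (ord_lo i) (ord_hi i) j) ^+ k.
Proof.
elim: k => [|k IHk]; first by rewrite mul1r mulr1.
by rewrite !exprSr -mulrA yt_yg !mulrA IHk.
Qed.

Lemma yt_lo_yg n (i : 'I_n.-1) k :
  yt (ord_lo i) ^+ k * yg i = yg i * yt (ord_hi i) ^+ k.
Proof. by rewrite ytX_yg tpermL. Qed.

Lemma yt_hi_yg n (i : 'I_n.-1) k :
  yt (ord_hi i) ^+ k * yg i = yg i * yt (ord_lo i) ^+ k.
Proof. by rewrite ytX_yg tpermR. Qed.

(** On these elements the rules of a Juyumaya trace, with cyclicity, reduce the value of the trace
    to Y_n. *)
Inductive yokonuma_span n : Y n.+1 -> Prop :=
| yokonuma_span_add a b :
    yokonuma_span a -> yokonuma_span b -> yokonuma_span (a + b)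
| yokonuma_span_t (a : Y n) (k : nat) :
    yokonuma_span (incl a * yt ord_max ^+ k)
| yokonuma_span_g (a b : Y n) (i : 'I_n.+1.-1) : i.+1 = n ->
    yokonuma_span (incl a * yg i * incl b).

Lemma yokonuma_span_incl n (a : Y n) : yokonuma_span (incl a).
Proof. by rewrite -[incl a]mulr1; apply: (yokonuma_span_t a 0). Qed.

Lemma yokonuma_span_mull n (a : Y n) b :
  yokonuma_span b -> yokonuma_span (incl a * b).
Proof.
elim=> [{}b c _ IHb _ IHc|b' k|b' c i ni].
- by rewrite mulrDr; apply: yokonuma_span_add.
- by rewrite mulrA -rmorphM; apply: yokonuma_span_t.
- by rewrite !mulrA -rmorphM; apply: yokonuma_span_g.
Qed.

Lemma yokonuma_span_mulr n (a : Y n) b :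
  yokonuma_span b -> yokonuma_span (b * incl a).
Proof.
elim=> [{}b c _ IHb _ IHc|b' k|b' c i ni].
- by rewrite mulrDl; apply: yokonuma_span_add.
- rewrite -mulrA -[_ ^+ k * _]commr_sym; last first.
    exact/commr_sym/commrX/commr_sym/yt_incl_comm.
  by rewrite mulrA -rmorphM; apply: yokonuma_span_t.
- by rewrite -!mulrA -rmorphM mulrA; apply: yokonuma_span_g.
Qed.

Lemma ord_hi_max n : ord_hi (ord_max : 'I_n.+2.-1) = ord_max.
Proof. exact/val_inj. Qed.

Lemma ord_lo_max n :
  ord_lo (ord_max : 'I_n.+2.-1) = widen_ord (leqnSn n.+1) ord_max.
Proof. exact/val_inj. Qed.

Lemma yt_lo_max n : yt (ord_lo (ord_max : 'I_n.+2.-1)) = incl (yt ord_max).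
Proof. by rewrite yokonuma_inclt ord_lo_max. Qed.

(** The only new case is t_(n+1): it commutes with Y_n, and t_(n+1) g_n = g_n t_n with t_n in
    Y_n. *)
Lemma yokonuma_span_mult n (j : 'I_n.+1) b :
  yokonuma_span b -> yokonuma_span (yt j * b).
Proof.
case: (eqVneq (j : nat) n) => [nj|nj]; last first.
  have ltjn : (j < n)%N by move: (ltn_ord j); rewrite ltnS leq_eqVlt (negPf nj).
  have -> : j = widen_ord (leqnSn n) (Ordinal ltjn) by apply/val_inj.
  by rewrite -yokonuma_inclt; apply: yokonuma_span_mull.
have -> : j = ord_max by apply/val_inj.
elim=> [{}b c _ IHb _ IHc|b' k|b' c i].
- by rewrite mulrDr; apply: yokonuma_span_add.
- by rewrite mulrA yt_incl_comm // -mulrA -exprS; exact: yokonuma_span_t.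
case: n j nj b b' c i => [//|n] j nj b b' c i [ni].
have -> : i = ord_max by apply/val_inj.
rewrite !mulrA yt_incl_comm // -[_ * _ * yg _]mulrA.
rewrite -ord_hi_max -[yt _]expr1 yt_hi_yg expr1 yt_lo_max -!mulrA -rmorphM.
by rewrite mulrA; apply: yokonuma_span_g.
Qed.

Lemma yokonuma_span_multX n (j : 'I_n.+1) k b :
  yokonuma_span b -> yokonuma_span (yt j ^+ k * b).
Proof.
by elim: k => [|k IHk] yb; rewrite ?mul1r // exprS -mulrA;
   apply/yokonuma_span_mult/IHk.
Qed.

Lemma yokonuma_spanZ n c (a : Y n.+1) :
  yokonuma_span a -> yokonuma_span (c *: a).
Proof.
rewrite -[a in c *: a]mul1r scalerAl -(rmorph1 (@yokonuma_incl K d u n)).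
by rewrite -linearZ; apply: yokonuma_span_mull.
Qed.

Lemma yokonuma_span_mule n (i : 'I_n.+1.-1) b :
  yokonuma_span b -> yokonuma_span (ye i * b).
Proof.
move=> yb; rewrite -scalerAl; apply: yokonuma_spanZ.
rewrite mulr_suml; elim/big_ind: _ => [|a c|k _].
- by rewrite -(raddf0 (@yokonuma_incl K d u n)); apply: yokonuma_span_incl.
- exact: yokonuma_span_add.
- by rewrite -mulrA; do 2 apply: yokonuma_span_multX.
Qed.

(** Same scheme as [hecke_spanP]; the framing generators t_j add the terms g a t^k g, and the
    quadratic relation produces e_i. *)
Lemma yokonuma_spanP n (a : Y n.+1) : yokonuma_span a.
Proof.
elim: n a => [|n IHn] a;
    elim/yokonuma_left_ind: a => [|c a|a b|i a|j a];
  try exact: yokonuma_span_add; try exact: yokonuma_spanZ;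
  try exact: yokonuma_span_mult;
  try by rewrite -(rmorph1 (@yokonuma_incl K d u _)); apply: yokonuma_span_incl.
  by case: i.
have gE (b : Y n.+1) : yokonuma_span (yg (ord_max : 'I_n.+2.-1) * incl b).
  by rewrite -[yg _]mul1r -(rmorph1 (@yokonuma_incl K d u n.+1));
     apply: yokonuma_span_g.
case: (eqVneq (i : nat) n) => [ni|ni]; last first.
  have ltin : (i < n)%N.
    by move: (ltn_ord i); rewrite /= ltnS leq_eqVlt (negPf ni).
  have -> : i = widen_ord (leq_pred n.+1) (Ordinal ltin : 'I_n.+1.-1).
    exact/val_inj.
  by rewrite -yokonuma_inclg; apply: yokonuma_span_mull.
have {ni} -> : i = ord_max by apply/val_inj.
elim=> [{}a b _ IHa _ IHb|{}a k|{}a b j [nj]].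
- by rewrite mulrDr; apply: yokonuma_span_add.
- have -> : incl a * yt ord_max ^+ k = yt ord_max ^+ k * incl a.
    exact/commrX/commr_sym/yt_incl_comm.
  rewrite mulrA -ord_hi_max -yt_lo_yg -mulrA.
  exact/yokonuma_span_multX/gE.
have -> : j = ord_max by apply/val_inj.
rewrite !mulrA; apply: yokonuma_span_mulr.
elim: (IHn a) => {a b nj j}.
- move=> a b _ IHa _ IHb.
  by rewrite raddfD mulrDr mulrDl; apply: yokonuma_span_add.
(* With g the last generator and t, t' the generators of the last two strands, g a t^k g = a t'^k
   g^2. The span is stable under t' and e, so the expansion of g^2 can be treated term by term. *)
- move=> a k; rewrite rmorphM rmorphXn /= -yt_lo_max mulrA yg_incl2_comm //.
  rewrite -!mulrA; apply: yokonuma_span_mull.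
  rewrite mulrA -yt_hi_yg -mulrA -expr2 yg_quad.
  apply: yokonuma_span_multX; rewrite -addrA; apply: yokonuma_span_add.
    rewrite -(rmorph1 (@yokonuma_incl K d u n.+1)).
    exact: yokonuma_span_incl.
  apply: yokonuma_span_add; apply: yokonuma_spanZ.
    rewrite -[ye _]mulr1 -(rmorph1 (@yokonuma_incl K d u n.+1)).
    exact/yokonuma_span_mule/yokonuma_span_incl.
  apply: yokonuma_span_mule.
  by rewrite -[yg _]mulr1 -(rmorph1 (@yokonuma_incl K d u n.+1)); apply: gE.
- move=> a b j nj.
  rewrite !rmorphM !mulrA /= yg_incl2_comm // yokonuma_inclg -!mulrA.
  rewrite -(yg_incl2_comm b (erefl : @ord_max n = n :> nat)) !mulrA.
  apply: yokonuma_span_mulr; rewrite -!mulrA; apply: yokonuma_span_mull.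
  rewrite !mulrA yg_braid; last by rewrite /= nj eqxx orbT.
  by rewrite -yokonuma_inclg; apply: yokonuma_span_g.
Qed.

End YokonumaSpan.

(** * Juyumaya traces *)

Section JuyumayaTrace.
Variables (K : fieldType) (d : nat) (u z : K) (x : nat -> K).
Notation Y := (yokonuma d u).
Notation yg := (@yg K d u _).
Notation yt := (@yt K d u _).
Notation ye := (@ye K d u _).
Notation incl := (@yokonuma_incl K d u _).
Notation top := (ord_max : 'I_(_.+2.-1)).
Variable tr : forall n, {scalar Y n}.
Hypotheses (d_gt0 : (0 < d)%N) (d_neq0 : d%:R != 0 :> K).
Hypotheses (x_sys : E_system d x) (trP : Juyumaya_trace z x tr).

Lemma tr_incl n (a : Y n) : tr n.+1 (incl a) = tr n a.
Proof. by case: trP. Qed.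

Lemma trC n (a b : Y n) : tr n (a * b) = tr n (b * a).
Proof. by case: trP. Qed.

Lemma tr1 n : tr n 1 = 1.
Proof. by case: trP. Qed.

Lemma tr_yg n (a : Y n.+1) : tr n.+2 (incl a * yg top) = z * tr n.+1 a.
Proof. by case: trP. Qed.

Lemma tr_yg_mid n (a b : Y n.+1) :
  tr n.+2 (incl a * yg top * incl b) = z * tr n.+1 (b * a).
Proof. by rewrite trC mulrA -rmorphM tr_yg. Qed.

Lemma yt_modn n (j : 'I_n) k : yt j ^+ (k %% d) = yt j ^+ k.
Proof.
by rewrite [in RHS](divn_eq k d) exprD mulnC exprM yt_expd expr1n mul1r.
Qed.

Lemma tr_ytX n (a : Y n) k :
  tr n.+1 (incl a * yt ord_max ^+ k) = x (k %% d) * tr n a.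
Proof.
rewrite -yt_modn; have [x0 _] := x_sys.
have [->|kd] := posnP (k %% d); first by rewrite mulr1 x0 mul1r tr_incl.
by case: trP => _ _ _ _ ->//; rewrite kd /= -ltnS prednK // ltn_mod.
Qed.

(** For the cyclic convolution the E-system reads (x * x)_k = x_k (x * x)_0; for k divisible by d
    this holds because [x 0 = 1]. *)
Lemma E_system_conv k :
  \sum_(s < d) x ((k + s) %% d)%N * x ((d - s) %% d)%N
  = x (k %% d)%N * \sum_(s < d) x s * x ((d - s) %% d)%N.
Proof.
have [x0 xm] := x_sys.
under eq_bigr do rewrite -modnDml.
have [->|kd] := posnP (k %% d).
  by rewrite x0 mul1r; apply: eq_bigr => s _; rewrite add0n modn_small.
by apply: xm; rewrite kd /= -ltnS prednK // ltn_mod.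
Qed.

(** This is E written through x alone; [trace_E_ye] identifies it with the trace of e_1. *)
Definition trace_ye : K := d%:R^-1 * \sum_(s < d) x s * x ((d - s) %% d)%N.
Notation E := trace_ye.

Lemma tr_yeE n (a : Y n.+1) :
  tr n.+2 (incl a * ye top)
  = d%:R^-1 * \sum_(s < d) tr n.+1 (a * yt ord_max ^+ s) * x ((d - s) %% d)%N.
Proof.
rewrite -scalerAr linearZ; congr (_ * _).
rewrite mulr_sumr linear_sum; apply: eq_bigr => s _ /=.
by rewrite yt_lo_max ord_hi_max -rmorphXn mulrA -rmorphM tr_ytX mulrC.
Qed.

(** Here the E-system enters: it settles a = b t^k with t the last framing generator. For a = b g c,
    the powers of t move across c and g into the smaller algebra, where the strong induction
    applies. *)
Lemma tr_ye n (a : Y n.+1) : tr n.+2 (incl a * ye top) = E * tr n.+1 a.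
Proof.
rewrite tr_yeE /E -mulrA; congr (_ * _).
elim/ltn_ind: n a => n IHn a; elim: (yokonuma_spanP a) => {a}.
- move=> a b _ IHa _ IHb; rewrite linearD mulrDr -IHa -IHb -big_split /=.
  by apply: eq_bigr => s _; rewrite mulrDl linearD mulrDl.
- move=> a k; rewrite tr_ytX mulrA [X in _ = X * _]mulrC -E_system_conv.
  rewrite mulr_suml.
  by apply: eq_bigr => s _; rewrite -mulrA -exprD tr_ytX mulrAC.
move=> a b i; case: n IHn a b i => [//|n] IHn a b i [ni].
have -> : i = top by apply/val_inj.
rewrite tr_yg_mid mulrCA -(IHn n) // mulr_sumr; apply: eq_bigr => s _.
rewrite mulrA; congr (_ * _); rewrite -mulrA.
have -> : incl b * yt ord_max ^+ s = yt ord_max ^+ s * incl b.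
  exact/commrX/commr_sym/yt_incl_comm.
rewrite -ord_hi_max mulrA -[_ * _ * _ ^+ _]mulrA -yt_lo_yg yt_lo_max.
by rewrite -rmorphXn mulrA -rmorphM tr_yg_mid mulrA.
Qed.

(** Each summand of e contributes equally: t_lo^s t_hi^(d-s) g = t_lo^s g t_lo^(d-s), and by
    cyclicity the two powers combine to t_lo^d = 1. *)
Lemma tr_yeg n (a : Y n.+1) :
  tr n.+2 (incl a * ye top * yg top) = z * tr n.+1 a.
Proof.
rewrite -scalerAr -scalerAl linearZ mulr_sumr mulr_suml linear_sum /=.
rewrite (eq_bigr (fun=> z * tr n.+1 a)) => [|s _].
  by rewrite sumr_const card_ord -[z * _ *+ d]mulr_natl mulKf.
rewrite -!mulrA yt_hi_yg yt_lo_max -!rmorphXn !mulrA -rmorphM tr_yg_mid trC.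
by rewrite -mulrA -exprD subnKC ?yt_expd ?mulr1 // ltnW.
Qed.

Lemma trace_E_ye : trace_E tr = E.
Proof.
have e0 : ord0 = ord_max :> 'I_2.-1 by apply/val_inj.
rewrite /trace_E e0 -[ye _]mul1r -(rmorph1 (@yokonuma_incl K d u 1)) tr_ye.
by rewrite tr1 mulr1.
Qed.

(** Congruence modulo the radical of the trace form. As [tr] is cyclic the radical is a two-sided
    ideal, whence [tr_equivM]. *)
Definition tr_equiv n (a b : Y n) : Prop :=
  forall c, tr n (c * a) = tr n (c * b).

(** Testing against the spanning set of Y_(n+1) reduces to Y_n: the trace of c t^k a is a multiple
    of that of c a, and the trace of c g c' a is z times that of c' a c. *)
Lemma tr_equiv_incl n (a b : Y n) : tr_equiv a b -> tr_equiv (incl a) (incl b).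
Proof.
move=> ab c; elim: (yokonuma_spanP c) => {c}.
- by move=> c c' _ IHc _ IHc'; rewrite !mulrDl !linearD /= IHc IHc'.
- move=> c k; rewrite -!mulrA.
  have tC e : yt ord_max ^+ k * incl e = incl e * yt ord_max ^+ k :> Y n.+1.
    exact/commr_sym/commrX/commr_sym/yt_incl_comm.
  by rewrite !tC !mulrA -!rmorphM !tr_ytX ab.
move=> c c' i; case: n a b ab c c' i => [//|n] a b ab c c' i [ni].
have -> : i = top by apply/val_inj.
rewrite -[_ * incl a]mulrA -[_ * incl b]mulrA -!rmorphM !tr_yg_mid.
by rewrite trC mulrA ab -mulrA trC.
Qed.

Lemma tr_equivM n (a a' b b' : Y n) :
  tr_equiv a a' -> tr_equiv b b' -> tr_equiv (a * b) (a' * b').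
Proof. by move=> aa bb c; rewrite mulrA bb trC mulrA aa -mulrA trC -mulrA. Qed.

Lemma tr_equivD n (a a' b b' : Y n) :
  tr_equiv a a' -> tr_equiv b b' -> tr_equiv (a + b) (a' + b').
Proof. by move=> aa bb c; rewrite !mulrDr !linearD /= aa bb. Qed.

Lemma tr_equivZ n k (a a' : Y n) : tr_equiv a a' -> tr_equiv (k *: a) (k *: a').
Proof. by move=> aa c; rewrite -!scalerAr !linearZ /= aa. Qed.

Lemma tr_equiv_tr n (a b : Y n) : tr_equiv a b -> tr n a = tr n b.
Proof. by move/(_ 1); rewrite !mul1r. Qed.

End JuyumayaTrace.

(** * Commutation rules for the idempotents e_i *)

Section YokonumaIdempotents.
Variables (K : fieldType) (d : nat) (u : K).
Notation Y := (yokonuma d u).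
Notation yg := (@yg K d u _).
Notation yt := (@yt K d u _).
Notation ye := (@ye K d u _).
Notation incl := (@yokonuma_incl K d u _).
Notation top := (ord_max : 'I_(_.+2.-1)).

Lemma yokonuma_incle n (i : 'I_n.-1) :
  incl (ye i) = ye (widen_ord (leq_pred n) i : 'I_n.+1.-1).
Proof.
rewrite linearZ raddf_sum; congr (_ *: _); apply: eq_bigr => s _ /=.
rewrite rmorphM !rmorphXn /= !yokonuma_inclt.
by congr (yt _ ^+ _ * yt _ ^+ _); apply/val_inj.
Qed.

(** Multiplying e_i by t_(i+1) or by t_i gives the same sum up to a shift of the summation index,
    which is cyclic as t^d = 1. *)
Lemma yt_hi_ye n (i : 'I_n.-1) k :
  yt (ord_hi i) ^+ k * ye i = yt (ord_lo i) ^+ k * ye i.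
Proof.
elim: k => [//|k IHk]; rewrite [in LHS]exprS [in RHS]exprSr -mulrA IHk.
rewrite mulrA -[in LHS](expr1 (yt (ord_hi i))) yt_commX -!mulrA expr1.
congr (_ * _); rewrite -!scalerAr; congr (_ *: _); rewrite !mulr_sumr.
pose F s := yt (ord_lo i) ^+ s * yt (ord_hi i) ^+ (d.+1 - s).
transitivity (\sum_(s < d) F s).
  apply: eq_bigr => s _; rewrite /F [RHS]yt_commX subSn ?(ltnW (ltn_ord s)) //.
  by rewrite exprS -mulrA yt_commX.
rewrite -sum_ord_shift.
  by apply: eq_bigr => s _; rewrite /F subSS exprS mulrA.
by rewrite /F subn0 subSnn exprS !yt_expd expr0 !mul1r mulr1.
Qed.

Lemma ye_incl2_comm n (a : Y n) : GRing.comm (ye top) (incl (incl a)).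
Proof.
rewrite /GRing.comm -scalerAl -scalerAr; congr (_ *: _).
rewrite mulr_suml mulr_sumr; apply: eq_bigr => s _.
apply/commr_sym/commrM; apply/commrX/commr_sym; last exact: yt_incl_comm.
by rewrite yt_lo_max /GRing.comm -!rmorphM yt_incl_comm.
Qed.

Lemma yg_quad_ye n (i : 'I_n.-1) :
  yg i ^+ 2 = 1 + (u - 1) *: (ye i * (1 + yg i)).
Proof.
rewrite yg_quad; move: (ye i) (yg i) => e g.
by rewrite mulrDr mulr1 scalerDr addrA.
Qed.

(** As e_i is idempotent, on its image the quadratic relation becomes the Hecke relation with
    parameter u. *)
Lemma ye_yg_quad n (i : 'I_n.-1) : d%:R != 0 :> K ->
  ye i * yg i ^+ 2 = u *: ye i + (u - 1) *: (ye i * yg i).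
Proof.
move=> d0; rewrite yg_quad; have := ye_idem u d0 i.
move: (ye i) (yg i) => e g ee; rewrite !mulrDr -!scalerAr mulrA ee mulr1.
by rewrite -[X in X + _ + _]scale1r -scalerDl subrKC.
Qed.

(** Passing through g_j g_i turns t_i into t_(i+1) and t_(i+1) into t_(i+2), hence e_i into e_j. *)
Lemma ye_braid n (i j : 'I_n.-1) : j = i.+1 :> nat ->
  ye i * (yg j * yg i) = yg j * yg i * ye j.
Proof.
move=> ij; rewrite -scalerAl -scalerAr; congr (_ *: _).
rewrite mulr_suml mulr_sumr; apply: eq_bigr => s _.
have hl : ord_hi i = ord_lo j by apply/val_inj; rewrite /= ij.
have loj : tperm (ord_lo j) (ord_hi j) (ord_lo i) = ord_lo i.
  by rewrite tpermD // -val_eqE /= ij ?neq_ltn ?ltnSn ?ltnS ?leqnSn ?orbT.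
have hij : tperm (ord_lo i) (ord_hi i) (ord_hi j) = ord_hi j.
  by rewrite tpermD // -val_eqE /= ij ?neq_ltn ?ltnSn ?ltnS ?leqnSn ?orbT.
rewrite -mulrA (mulrA (yt (ord_hi i) ^+ _)) hl yt_lo_yg -hl.
rewrite -[yg j * _ * _]mulrA ytX_yg hij !mulrA ytX_yg loj.
by rewrite -[yg j * _ * _]mulrA yt_lo_yg hl !mulrA.
Qed.

End YokonumaIdempotents.

(** * The radical of the trace form *)

Section TraceRelations.
Variables (K : fieldType) (d : nat) (u z : K) (x : nat -> K).
Notation Y := (yokonuma d u).
Notation yg := (@yg K d u _).
Notation yt := (@yt K d u _).
Notation ye := (@ye K d u _).
Notation incl := (@yokonuma_incl K d u _).
Notation top := (ord_max : 'I_(_.+2.-1)).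
Variable tr : forall n, {scalar Y n}.
Hypotheses (d_gt0 : (0 < d)%N) (d_neq0 : d%:R != 0 :> K).
Hypotheses (x_sys : E_system d x) (trP : Juyumaya_trace z x tr).
Notation E := (trace_ye d x).
Notation "a ~~ b" := (tr_equiv tr a b) (at level 70).

Let trC n (a b : Y n) : tr n (a * b) = tr n (b * a) := trC trP a b.

Lemma tr_ye_1Dyg n (a : Y n.+1) k :
  tr n.+2 (incl a * yt ord_max ^+ k * (ye top * (1 + yg top)))
  = (E + z) * tr n.+1 (a * yt ord_max ^+ k).
Proof.
rewrite mulrA -[incl a * _ * _]mulrA -ord_hi_max yt_hi_ye yt_lo_max -rmorphXn.
rewrite mulrA -rmorphM mulrDr mulr1 linearD /=.
by rewrite (tr_ye d_gt0 x_sys trP) (tr_yeg d_neq0 trP) mulrDl.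
Qed.

(** By [tr_ye_1Dyg] the pairing with a t^k has the factor E + z = 0. The remaining elements a g b of
    the spanning set are reduced to this case or to fewer strands by splitting b. *)
Lemma ye_1Dyg_null n (i : 'I_n.-1) : z = - E -> ye i * (1 + yg i) ~~ 0.
Proof.
move=> zE; elim: n i => [[]//|n IHn] i.
case: (ltnP i.+1 n) => [|ni].
  rewrite -ltn_predRL => ltin.
  have -> : i = widen_ord (leq_pred n) (Ordinal ltin) by apply/val_inj.
  rewrite -yokonuma_incle -yokonuma_inclg.
  rewrite -[1](rmorph1 (@yokonuma_incl K d u n)).
  rewrite -rmorphD -rmorphM -(raddf0 (@yokonuma_incl K d u n)).
  exact/(tr_equiv_incl d_gt0 x_sys trP)/IHn.
case: n IHn i ni => [|n] IHn i ni; first by case: i ni.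
have -> : i = top.
  by apply/val_inj/eqP; rewrite eqn_leq -ltnS ltn_ord -ltnS.
have top0 (a : Y n.+1) k :
    tr n.+2 (incl a * yt ord_max ^+ k * (ye top * (1 + yg top))) = 0.
  by rewrite tr_ye_1Dyg zE subrr mul0r.
move=> c; rewrite mulr0 linear0; elim: (yokonuma_spanP c) => {c i ni}.
- by move=> a b _ IHa _ IHb; rewrite mulrDl linearD /= IHa IHb addr0.
- by move=> a k; apply: top0.
move=> a b i [ni]; have {ni} -> : i = top by apply/val_inj.
elim: (yokonuma_spanP b) => {b i}.
- move=> b c _ IHb _ IHc.
  by rewrite raddfD mulrDr mulrDl linearD /= IHb IHc addr0.
(* Here g e (1 + g) = e g + e g^2 = u e (1 + g), so g is absorbed and [top0] applies. *)
- move=> b k; rewrite rmorphM rmorphXn /= -yt_lo_max !mulrA.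
  rewrite -[_ * incl (incl b)]mulrA.
  rewrite yg_incl2_comm // !mulrA -rmorphM -[_ * yg _ * _ ^+ _]mulrA -yt_hi_yg.
  rewrite -!mulrA (mulrA (yg top)) -ye_yg // mulrDr mulr1.
  have -> : ye top * yg top + ye top * yg top * yg top
     = u *: (ye top * (1 + yg top)) :> Y n.+2.
    rewrite -mulrA -expr2 ye_yg_quad // mulrDr mulr1 scalerDr addrCA.
    by rewrite -[X in _ + (X + _)]scale1r -scalerDl subrKC.
  by rewrite -!scalerAr linearZ /= ord_hi_max mulrA top0 mulr0.
move=> b1 b2 i; case: n IHn a b1 b2 i {top0} => [//|n] IHn a b1 b2 i [ni].
have {ni} -> : i = top by apply/val_inj.
have gi : yg (widen_ord (leq_pred n.+2) top : 'I_n.+3.-1) = incl (yg top).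
  by rewrite yokonuma_inclg.
(* Conjugation by the last two generators moves the element to the preceding pair of strands, where
   the induction hypothesis applies. *)
have eg : yg top * incl (yg top) * (ye top * (1 + yg top))
        = incl (ye top * (1 + yg top)) * (yg top * incl (yg top)) :> Y n.+3.
  rewrite rmorphM rmorphD rmorph1 /= yokonuma_incle -gi.
  set j := widen_ord _ _; have jt : (ord_max : 'I_n.+3.-1) = j.+1 :> nat by [].
  rewrite mulrA -ye_braid // -!mulrA; congr (_ * _).
  rewrite !mulrDr !mulrDl mulr1 mul1r !mulrA; congr (_ + _).
  by rewrite yg_braid // jt eqxx ?orbT.
have e2 : GRing.comm (ye top * (1 + yg top)) (incl (incl b2)).
  apply/commr_sym/commrM; first exact/commr_sym/ye_incl2_comm.
  by apply: commrD; [exact: commr1|exact/commr_sym/yg_incl2_comm].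
have := IHn (ord_max : 'I_n.+2.-1); move: eg e2.
move: (ye top * (1 + yg top)) (ye top * (1 + yg top)) => Z' Z eg e2 Z'0.
have -> : incl a * yg top * incl (incl b1 * yg top * incl b2) * Z
        = incl (a * incl b1 * Z') * yg top * incl (yg top * incl b2).
  rewrite !rmorphM /= !mulrA -[_ * incl (incl b2) * Z]mulrA -e2 mulrA.
  rewrite -[_ * yg top * incl (incl b1)]mulrA yg_incl2_comm // mulrA.
  by rewrite -[_ * yg top * incl (yg top)]mulrA -[_ * Z]mulrA eg !mulrA.
by rewrite (tr_yg_mid trP) mulrA (Z'0 _) mulr0 linear0 mulr0.
Qed.

(** If x is a sequence of powers, appending t multiplies the trace by w on the elements a t^k; on a
    g b, t passes through g to a strand with smaller index. *)
Lemma tr_equiv_yt w n (j : 'I_n) :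
  (forall k, x (k %% d) = w ^+ k) -> yt j ~~ w%:A.
Proof.
move=> xw; elim: n j => [[]//|n IHn] j.
case: (ltnP j n) => [ltjn|nj].
  have -> : j = widen_ord (leqnSn n) (Ordinal ltjn) by apply/val_inj.
  rewrite -yokonuma_inclt -[1](rmorph1 (@yokonuma_incl K d u n)) -linearZ.
  exact/(tr_equiv_incl d_gt0 x_sys trP)/IHn.
have {nj} -> : j = ord_max.
  by apply/val_inj/eqP; rewrite eqn_leq -ltnS ltn_ord.
move=> c; rewrite -scalerAr mulr1 linearZ /=.
elim: (yokonuma_spanP c) => {c j} [a b _ IHa _ IHb|a k|a b i].
- by rewrite mulrDl !linearD mulrDr /= IHa IHb.
- by rewrite -mulrA -exprSr !(tr_ytX d_gt0 x_sys trP) !xw exprS mulrA.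
case: n IHn a b i => [//|n] IHn a b i [ni].
have {ni} -> : i = top by apply/val_inj.
rewrite -mulrA -(yt_incl_comm b) // mulrA -[_ * yg _ * _]mulrA.
rewrite -ord_hi_max -[yt _]expr1 -yt_lo_yg expr1 yt_lo_max mulrA -rmorphM.
rewrite !(tr_yg_mid trP) mulrA (IHn _ (b * a)).
by rewrite -scalerAr mulr1 linearZ mulrCA.
Qed.

Lemma tr_equiv_sum n (I : Type) (s : seq I) (F G : I -> Y n) :
  (forall i, F i ~~ G i) -> \sum_(i <- s) F i ~~ \sum_(i <- s) G i.
Proof.
move=> FG c; rewrite !mulr_sumr !linear_sum.
by apply: eq_bigr => i _; apply: FG.
Qed.

Lemma tr_equivX n (a b : Y n) k : a ~~ b -> a ^+ k ~~ b ^+ k.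
Proof.
move=> ab; elim: k => [|k IHk]; first by [].
by rewrite !exprS; apply: (tr_equivM trP).
Qed.

(** Since w^d = [x 0] = 1, replacing each t_j by w turns every summand of e_i into 1. *)
Lemma tr_equiv_ye w n (i : 'I_n.-1) :
  (forall k, x (k %% d) = w ^+ k) -> ye i ~~ 1.
Proof.
move=> xw; have wd : w ^+ d = 1.
  by have [x0 _] := x_sys; rewrite -xw modnn.
have -> : 1 = d%:R^-1 *: \sum_(s < d) (w%:A ^+ s * w%:A ^+ (d - s)) :> Y n.
  rewrite (eq_bigr (fun=> 1)) => [|s _].
    by rewrite sumr_const card_ord -scaler_nat scalerA mulVf // scale1r.
  by rewrite -exprD subnKC ?(ltnW (ltn_ord s)) // exprZn expr1n wd scale1r.
apply: tr_equivZ; apply: tr_equiv_sum => s.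
by apply: (tr_equivM trP); apply: tr_equivX; apply: tr_equiv_yt.
Qed.

Lemma tr_equiv_yg_quad w n (i : 'I_n.-1) :
    u = 1 \/ (forall k, x (k %% d) = w ^+ k) ->
  yg i ^+ 2 ~~ (u - 1) *: yg i + u%:A.
Proof.
rewrite yg_quad => -[u1|xw].
  have -> : u - 1 = 0 by rewrite u1 subrr.
  by rewrite [X in X%:A]u1 !scale0r add0r !addr0 scale1r.
have -> : (u - 1) *: yg i + u%:A
   = 1 + (u - 1) *: 1 + (u - 1) *: (1 * yg i) :> Y n.
  by rewrite mul1r addrC -[X in X + _ + _]scale1r -scalerDl subrKC.
have ye1 := tr_equiv_ye i xw.
apply: tr_equivD; last by apply: tr_equivZ; apply: (tr_equivM trP).
by apply: tr_equivD => //; apply: tr_equivZ.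
Qed.

Lemma tr_equiv_yg_quad_opp n (i : 'I_n.-1) : z = - E -> yg i ^+ 2 ~~ 1.
Proof.
move=> zE; rewrite yg_quad_ye.
rewrite -[1 in X in _ ~~ X]addr0 -[0](scaler0 _ (u - 1)).
by apply: tr_equivD => //; apply/tr_equivZ/ye_1Dyg_null.
Qed.

(* g_2 t_1^s t_2^(-s) g_2 = t_1^s g_2^2 t_3^(-s). *)
Lemma tr_yg_ye_yg n (a : Y n.+2) :
  tr n.+3 (incl a * (yg top * incl (ye top) * yg top))
  = d%:R^-1 * (\sum_(s < d) x ((d - s) %% d) *
                 tr n.+2 (a * yt (ord_lo top) ^+ s))
    + (u - 1) * (E + z) * tr n.+2 (a * ye top).
Proof.
have -> : yg top * incl (ye top) * yg top
  = d%:R^-1 *: \sum_(s < d) incl (yt (ord_lo top) ^+ s) * yg top ^+ 2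
                            * yt ord_max ^+ (d - s) :> Y n.+3.
  rewrite [incl (ye _)]linearZ raddf_sum -scalerAr -scalerAl.
  rewrite mulr_sumr mulr_suml.
  congr (_ *: _); apply: eq_bigr => s _ /=.
  rewrite rmorphM !rmorphXn mulrA /= ord_hi_max -yt_lo_max -mulrA yt_lo_yg.
  have C : GRing.comm (yg top) (incl (yt (ord_lo top)) ^+ s :> Y n.+3).
    by rewrite yt_lo_max; apply/commrX/yg_incl2_comm.
  by rewrite mulrA C ord_hi_max expr2 !mulrA.
rewrite -scalerAr linearZ /= mulr_sumr linear_sum.
rewrite (eq_bigr (fun s : 'I_d =>
     x ((d - s) %% d) * tr n.+2 (a * yt (ord_lo top) ^+ s)
   + (u - 1) * (E + z)
     * tr n.+2 (a * (yt (ord_lo top) ^+ s * yt ord_max ^+ (d - s))))).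
  rewrite big_split /= mulrDr; congr (_ + _).
  rewrite -mulr_sumr mulrCA; congr (_ * _).
  rewrite -[in RHS]scalerAr linearZ /= ord_hi_max; congr (_ * _).
  by rewrite mulr_sumr linear_sum.
(* In g^2 = 1 + (u - 1) e (1 + g) the term 1 yields x_(d-s), and the other term yields the factor E
   + z by [tr_ye_1Dyg]. *)
move=> s _; rewrite yg_quad_ye.
move: (ye top * _) (tr_ye_1Dyg (a * yt (ord_lo top) ^+ s) (d - s)) => e te.
rewrite mulrDr mulr1 mulrDl mulrDr linearD /=.
rewrite [X in tr _ X + _]mulrA -[X in tr _ (X * _) + _]rmorphM.
rewrite (tr_ytX d_gt0 x_sys trP); congr (_ + _).
rewrite -scalerAr -scalerAl -scalerAr linearZ /= -[RHS]mulrA; congr (_ * _).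
rewrite [a * (_ * _)]mulrA -te !mulrA -rmorphM [LHS]trC mulrA.
congr (tr _ (_ * _)); exact/commr_sym/commrX/commr_sym/yt_incl_comm.
Qed.

(** The braid relation and the rules for t give g_2 e_1 g_1 g_2 = g_1 e_2 g_2 g_1 (for the last two
    generators); then [tr_yeg] removes e_2 g_2. *)
Lemma tr_yg_yeyg_yg n (a : Y n.+2) :
  tr n.+3 (incl a * (yg top * incl (ye top * yg top) * yg top))
  = z * tr n.+2 (yg top * a * yg top).
Proof.
have -> : yg top * incl (ye top * yg top) * yg top
        = incl (yg top) * ye top * yg top * incl (yg top) :> Y n.+3.
  rewrite -scalerAl linearZ -[in RHS]scalerAr -!scalerAr -!scalerAl.
  congr (_ *: _); rewrite mulr_suml raddf_sum !mulr_sumr !mulr_suml.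
  apply: eq_bigr => s _ /=; rewrite !rmorphM !rmorphXn /= ord_hi_max -yt_lo_max.
  have C1 : GRing.comm (yg top) (incl (yt (ord_lo top)) ^+ s :> Y n.+3).
    by rewrite yt_lo_max; apply/commrX/yg_incl2_comm.
  have C3 : GRing.comm (yt ord_max ^+ (d - s)) (incl (yg top) :> Y n.+3).
    exact/commr_sym/commrX/commr_sym/yt_incl_comm.
  have gb : yg top * incl (yg top) * yg top
          = incl (yg top) * yg top * incl (yg top) :> Y n.+3.
    by rewrite yokonuma_inclg yg_braid // eqxx ?orbT.
  have l12 : incl (yt (ord_lo top)) ^+ s * incl (yg top)
      = incl (yg top) * yt (ord_lo top) ^+ s :> Y n.+3.
    rewrite -rmorphXn -rmorphM /= yt_lo_yg rmorphM rmorphXn /=.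
    by rewrite ord_hi_max yt_lo_max.
  rewrite !mulrA C1 -[_ * yg top * _ ^+ _]mulrA -yt_hi_yg ord_hi_max.
  rewrite mulrA -!mulrA (mulrA (yg top)) gb -!mulrA (mulrA (_ ^+ (d - s))) C3.
  by rewrite !mulrA l12.
rewrite !mulrA -rmorphM trC !mulrA -!rmorphM (tr_yeg d_neq0 trP).
by rewrite mulrA.
Qed.
End TraceRelations.

(** * Necessary conditions *)

Section SkeinEquations.
Variables (K : fieldType) (d : nat) (u z : K) (x : nat -> K).
Notation Y := (yokonuma d u).
Notation yg := (@yg K d u _).
Notation yt := (@yt K d u _).
Notation ye := (@ye K d u _).
Notation incl := (@yokonuma_incl K d u _).
Notation top := (ord_max : 'I_(_.+2.-1)).
Variable tr : forall n, {scalar Y n}.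
Hypotheses (d_gt0 : (0 < d)%N) (d_neq0 : d%:R != 0 :> K).
Hypotheses (x_sys : E_system d x) (trP : Juyumaya_trace z x tr).
Notation E := (trace_ye d x).
(** In the application a = r (q - 1) and b = r^2 q, so that X^2 - a X - b = (X - r q) (X + r). *)
Variables a b : K.
Hypothesis skein : forall n (w : seq 'I_n.-1) (i : 'I_n.-1),
  tr n (\prod_(j <- w) yg j * yg i ^+ 2)
  = a * tr n (\prod_(j <- w) yg j * yg i) + b * tr n (\prod_(j <- w) yg j).

Let g : Y 2 := yg top.
Let e : Y 2 := ye top.

Let tr_t k : tr 2 (yt (ord_lo top) ^+ k) = x (k %% d).
Proof.
rewrite yt_lo_max -rmorphXn (tr_incl trP) -[_ ^+ k]mul1r.
rewrite -(rmorph1 (@yokonuma_incl K d u 0)) (tr_ytX d_gt0 x_sys trP).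
by rewrite (tr1 trP) mulr1.
Qed.

Let tr_tg k : tr 2 (yt (ord_lo top) ^+ k * g) = z * x (k %% d).
Proof. by rewrite -tr_t yt_lo_max -rmorphXn (tr_yg trP) (tr_incl trP). Qed.

Let tr_te k : tr 2 (yt (ord_lo top) ^+ k * e) = E * x (k %% d).
Proof.
by rewrite -tr_t yt_lo_max -rmorphXn (tr_ye d_gt0 x_sys trP) (tr_incl trP).
Qed.

Let tr_teg k : tr 2 (yt (ord_lo top) ^+ k * (e * g)) = z * x (k %% d).
Proof.
by rewrite -tr_t yt_lo_max -rmorphXn mulrA (tr_yeg d_neq0 trP) (tr_incl trP).
Qed.

Let x0 : x 0 = 1. Proof. by case: x_sys. Qed.

Let trg : tr 2 g = z.
Proof. by rewrite -[g]mul1r (tr_tg 0) mod0n x0 mulr1. Qed.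
Let tre : tr 2 e = E.
Proof. by rewrite -[e]mul1r (tr_te 0) mod0n x0 mulr1. Qed.
Let treg : tr 2 (e * g) = z.
Proof. by rewrite -[_ * _]mul1r (tr_teg 0) mod0n x0 mulr1. Qed.

Let gg : g * g = 1 + (u - 1) *: e + (u - 1) *: (e * g).
Proof. by rewrite -expr2 yg_quad. Qed.
Let egg : e * g * g = u *: e + (u - 1) *: (e * g).
Proof. by rewrite -mulrA -expr2 ye_yg_quad. Qed.

Let trDZ n (c1 c2 : K) (v1 v2 v3 : Y n) :
  tr n (v1 + c1 *: v2 + c2 *: v3) = tr n v1 + c1 * tr n v2 + c2 * tr n v3.
Proof. by rewrite !linearD !linearZ. Qed.

Let trZ2 n (c1 c2 : K) (v1 v2 : Y n) :
  tr n (c1 *: v1 + c2 *: v2) = c1 * tr n v1 + c2 * tr n v2.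
Proof. by rewrite linearD !linearZ. Qed.

Let trgg : tr 2 (g * g) = 1 + (u - 1) * E + (u - 1) * z.
Proof. by rewrite gg trDZ (tr1 trP) tre treg. Qed.

Let tregg : tr 2 (e * g * g) = u * E + (u - 1) * z.
Proof. by rewrite egg trZ2 tre treg. Qed.

Let skein2 k :
  tr 2 (g ^+ k * (g * g)) = a * tr 2 (g ^+ k * g) + b * tr 2 (g ^+ k).
Proof.
have := skein (nseq k (ord_max : 'I_2.-1)) ord_max.
by rewrite big_nseq iter_mulr_1.
Qed.

Let mulDZl n (c1 c2 : K) (v1 v2 v3 w : Y n) :
  (v1 + c1 *: v2 + c2 *: v3) * w = v1 * w + c1 *: (v2 * w) + c2 *: (v3 * w).
Proof. by rewrite !mulrDl -!scalerAl. Qed.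

Let mulZ2l n (c1 c2 : K) (v1 v2 w : Y n) :
  (c1 *: v1 + c2 *: v2) * w = c1 *: (v1 * w) + c2 *: (v2 * w).
Proof. by rewrite !mulrDl -!scalerAl. Qed.

Let trg3 :
  tr 2 (g * (g * g)) = z + (u - 1) * z + (u - 1) * (u * E + (u - 1) * z).
Proof. by rewrite mulrA gg mulDZl mul1r trDZ trg treg tregg. Qed.

Let treg3 : tr 2 (e * (g * (g * g))) = u * z + (u - 1) * (u * E + (u - 1) * z).
Proof. by rewrite 2!mulrA egg mulZ2l trZ2 treg tregg. Qed.

Let trg4 : tr 2 (g ^+ 2 * (g * g))
  = 1 + (u - 1) * E + (u - 1) * z + (u - 1) * (u * E + (u - 1) * z)
    + (u - 1) * (u * z + (u - 1) * (u * E + (u - 1) * z)).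
Proof.
rewrite expr2 {1}gg mulDZl mul1r trDZ trgg -treg3 -tregg.
by rewrite -mulrA -[e * g * _]mulrA.
Qed.

(** The empty word on two strands. *)
Lemma skein_eq0 : (1 - b) - a * z + (u - 1) * (E + z) = 0.
Proof.
have := skein2 0; rewrite !mul1r trgg trg (tr1 trP) => h.
transitivity (1 + (u - 1) * E + (u - 1) * z - (a * z + b * 1)); first by ring.
by rewrite h subrr.
Qed.

(** The word s_1. *)
Lemma skein_eq1 :
  (1 - b) * z - a * (1 + (u - 1) * (E + z)) + (u - 1) * u * (E + z) = 0.
Proof.
have := skein2 1; rewrite expr1 trg3 trgg trg => h.
transitivity (z + (u - 1) * z + (u - 1) * (u * E + (u - 1) * z)
  - (a * (1 + (u - 1) * E + (u - 1) * z) + b * z)); first by ring.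
by rewrite h subrr.
Qed.

(* The braid s_1^2, minus the equation of the trivial braid. *)
Lemma skein_eq2 : (u - 1) * (E + z) * (u ^+ 2 - a * u - b) = 0.
Proof.
have := skein2 2; rewrite trg4 expr2 -mulrA trg3 trgg => h.
have h0 := skein_eq0.
transitivity (1 + (u - 1) * E + (u - 1) * z + (u - 1) * (u * E + (u - 1) * z)
    + (u - 1) * (u * z + (u - 1) * (u * E + (u - 1) * z))
  - (a * (z + (u - 1) * z + (u - 1) * (u * E + (u - 1) * z))
     + b * (1 + (u - 1) * E + (u - 1) * z))
  - ((1 - b) - a * z + (u - 1) * (E + z))); first by ring.
by rewrite h h0 subrr subr0.
Qed.

Let G : Y 3 := yg top.

(* The braid s_2 s_1^2 s_2, minus s_2^2. *)
Lemma skein_eq3 : (u - 1) ^+ 2 * (E + z) * (1 - b) * (1 - E) = 0.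
Proof.
pose X := g * g - a *: g - b *: 1.
have XE : X = (1 - b) *: 1 + (- a) *: g + (u - 1) *: e + (u - 1) *: (e * g).
  rewrite /X gg [(1 - b)%:A]scalerBl scale1r scaleNr.
  by rewrite [LHS](@GRing.add (Y 2)).[ACl 1*5*4*2*3].
have trX (v : Y 2) : tr 2 (v * X) = (1 - b) * tr 2 v - a * tr 2 (v * g)
     + (u - 1) * tr 2 (v * e) + (u - 1) * tr 2 (v * (e * g)).
  by rewrite XE !mulrDr -!scalerAr mulr1 trDZ trZ2 mulNr.
have trX' (v : Y 2) :
    tr 2 (v * X) = tr 2 (v * (g * g)) - a * tr 2 (v * g) - b * tr 2 v.
  by rewrite /X !mulrBr -!scalerAr mulr1 !linearB !linearZ.
have X1 : tr 2 X = 0.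
  by rewrite -[X]mul1r trX' -(expr0 g) skein2; ring.
have Xgg : tr 2 (g * g * X) = 0.
  by rewrite trX'; have := skein2 2; rewrite expr2 => ->; ring.
have XW (w : seq 'I_3.-1) :
    tr 3 (\prod_(j <- w) yg j * incl X) = 0.
  have := skein w (widen_ord (leq_pred 2) (top : 'I_2.-1)).
  rewrite -yokonuma_inclg -/g => h.
  have -> : incl X = incl g ^+ 2 - a *: incl g - b *: 1.
    rewrite !linearB expr2 -rmorphM /=; congr (_ - _ - _); first exact: linearZ.
    by rewrite linearZ /= rmorph1.
  rewrite !mulrBr !linearB /= h -!scalerAr mulr1 !linearZ /=; ring.
have X3 : tr 3 (G * incl (g * g) * G * incl X) = 0.
  pose i1 : 'I_3.-1 := widen_ord (leq_pred 2) (top : 'I_2.-1).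
  have := XW [:: top; i1; i1; top].
  by rewrite !big_cons big_nil -!yokonuma_inclg mulr1 !mulrA rmorphM /= !mulrA.
have X2 : tr 3 (G * G * incl X) = 0.
  by have := XW [:: top; top]; rewrite !big_cons big_nil mulr1.
(* Since g^2 - 1 = (u - 1) (e + e g), subtracting the equation of s_2^2 from that of s_2 s_1^2 s_2
   leaves these two traces. *)
have : (u - 1) * (tr 3 (G * incl e * G * incl X)
                 + tr 3 (G * incl (e * g) * G * incl X)) = 0.
  have mid (c : K) (v1 v2 : Y 2) (v : Y 3) :
      G * incl (1 + c *: v1 + c *: v2) * G * v
      = G * G * v + c *: (G * incl v1 * G * v) + c *: (G * incl v2 * G * v).
    rewrite !linearD !linearZ /= rmorph1 !mulrDr mulr1 !mulrDl.
    by rewrite -!scalerAr -!scalerAl.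
  by move: X3; rewrite gg mid trDZ X2 add0r -mulrDr.
rewrite [in tr 3 (G * incl e * _ * _)](trC trP).
rewrite [in tr 3 (G * incl (e * g) * _ * _)](trC trP).
rewrite (tr_yg_ye_yg d_gt0 d_neq0 x_sys trP) (tr_yg_yeyg_yg d_neq0 trP).
rewrite (trC trP (g * X)) mulrA Xgg mulr0 addr0.
(* Multiplication by t_1^k scales the traces of 1, g, e and e g by the same factor x_k, so it scales
   the trace of X, which is 0. *)
have trtX k : tr 2 (X * yt (ord_lo top) ^+ k) = 0.
  rewrite (trC trP) trX tr_t tr_tg tr_te tr_teg -[RHS](mulr0 (x (k %% d))).
  by rewrite -X1 -[X]mul1r trX !mul1r (tr1 trP) trg tre treg; ring.
rewrite big1 ?mulr0 ?add0r => [|s _]; last by rewrite trtX mulr0.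
have ee : e * e = e by apply: ye_idem.
(* What survives is the trace of e X. It differs from the left side of [skein_eq0] only by E in
   place of 1 next to 1 - b, and so equals - (1 - b) (1 - E). *)
rewrite (trC trP) trX (mulrA e) ee tre treg => h.
rewrite -[RHS](mulr0 (-1)) -h.
transitivity (- ((u - 1) * ((u - 1) * (E + z)
       * ((1 - b) * E - a * z + (u - 1) * E + (u - 1) * z)))
   + (u - 1) ^+ 2 * (E + z) * ((1 - b) - a * z + (u - 1) * (E + z))).
  by ring.
by rewrite skein_eq0 mulr0 addr0 mulN1r.
Qed.


End SkeinEquations.

(** * Solving the polynomial system *)

Definition parameter_cases (K : fieldType) (q zeta u z E : K) : Prop :=
     (q = 1 /\ zeta = z /\ u = 1)
    \/ (q = 1 /\ zeta = - z /\ u = 1)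
    \/ (zeta = q /\ u = 1 /\ z = 1)
    \/ (zeta = q /\ u = 1 /\ z = - 1)
    \/ (zeta = - 1 /\ u = 1 /\ z = 1)
    \/ (zeta = - 1 /\ u = 1 /\ z = - 1)
    \/ (q = 1 /\ zeta = E /\ z = - E)
    \/ (q = 1 /\ zeta = - E /\ z = - E)
    \/ (zeta = q /\ z = - 1 /\ E = 1)
    \/ (zeta = q /\ z = u /\ E = 1)
    \/ (zeta = - 1 /\ z = - 1 /\ E = 1)
    \/ (zeta = - 1 /\ z = u /\ E = 1)
    \/ (q = u /\ zeta = z /\ E = 1)
    \/ (q = u^-1 /\ zeta = - z / u /\ E = 1).

(** Three ranges are treated: u = 1, then E = 1, then neither. In each, combinations of the
    equations factor, mostly through values of X^2 - a X - b, whose roots are r q and - r. *)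
Lemma skein_equations_solve (K : fieldType) (q zeta u z E r a b : K) :
    2 != 0 :> K -> 1 + E != 0 -> q != 0 -> u != 0 -> r != 0 ->
    z = r * zeta -> a = r * (q - 1) -> b = r ^+ 2 * q ->
    (1 - b) - a * z + (u - 1) * (E + z) = 0 ->
    (1 - b) * z - a * (1 + (u - 1) * (E + z)) + (u - 1) * u * (E + z) = 0 ->
    (u - 1) * (E + z) * (u ^+ 2 - a * u - b) = 0 ->
    (u - 1) ^+ 2 * (E + z) * (1 - b) * (1 - E) = 0 ->
  parameter_cases q zeta u z E.
Proof.
rewrite /parameter_cases => two0 E0 q0 u0 r0 zr ar br.
set t0 := _ - _ + _ => T0; set t1 := _ - _ + _ => T1; set t2 := _ * _ => T2 T3.
have zq v : v = r * q -> z = v -> zeta = q.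
  by move=> -> zv; apply: (mulfI r0); rewrite -zr.
have z1 v : v = - r -> z = v -> zeta = - 1.
  by move=> -> zv; apply: (mulfI r0); rewrite -zr zv mulrN1.
have a0 : a = 0 -> b = 1 -> q = 1 /\ (r = 1 \/ r = -1).
  move=> a0 b1; have q1 : q = 1.
    move: ar; rewrite a0 => /esym/eqP.
    by rewrite mulf_eq0 (negPf r0) subr_eq0 => /eqP.
  split=> //; move: br; rewrite q1 b1 mulr1 => /esym/eqP.
  by rewrite sqrf_eq1 => /orP[] /eqP; [left|right].
(* This is the value of X^2 - a X - b at -1. *)
have fN1 : 1 + a - b = 0 -> r * q = -1 \/ r = 1.
  rewrite ar br => h; have /eqP : (1 + r * q) * (1 - r) = 0 by rewrite -h; ring.
  rewrite mulf_eq0 => /orP[] /eqP h'; [left|right].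
    by apply/eqP; rewrite -subr_eq0 opprK addrC h'.
  by apply/esym/eqP; rewrite -subr_eq0 h'.
have fv v : v ^+ 2 - a * v - b = 0 -> v = r * q \/ v = - r.
  rewrite ar br => h; have /eqP : (v - r * q) * (v + r) = 0 by rewrite -h; ring.
  by rewrite mulf_eq0 subr_eq0 addr_eq0 => /orP[] /eqP; [left|right].
have [u1|u1] := eqVneq u 1.
  have e1 : 1 - b = a * z.
    by apply/eqP; rewrite -subr_eq0; apply/eqP; rewrite -[RHS]T0 /t0 u1; ring.
  have /eqP : a * (z ^+ 2 - 1) = 0 by rewrite -T1 /t1 e1 u1; ring.
  rewrite mulf_eq0 subr_eq0 sqrf_eq1 => /or3P[] /eqP h.
  - have b1 : b = 1 by apply/esym/eqP; rewrite -subr_eq0 e1 h mul0r.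
    by have [-> [] r1] := a0 h b1; rewrite zr r1 ?mul1r ?mulN1r ?opprK; tauto.
  - have /fv : 1 ^+ 2 - a * 1 - b = 0.
      by rewrite -T0 /t0 h u1; ring.
    by case=> h'; [have := zq _ h' h|have := z1 _ h' h]; tauto.
  - have /fv : (-1) ^+ 2 - a * (-1) - b = 0.
      by rewrite -T0 /t0 h u1; ring.
    by case=> h'; [have := zq _ h' h|have := z1 _ h' h]; tauto.
have u10 : u - 1 != 0 by rewrite subr_eq0.
have [E1|E1] := eqVneq E 1.
  have /eqP : (1 + a - b) * (z - u) = 0.
    transitivity (t1 - u * t0); first by rewrite /t1 /t0 E1; ring.
    by rewrite T0 T1 mulr0 subr0.
  have /eqP : (u ^+ 2 - a * u - b) * (1 + z) = 0.
    transitivity (t1 + t0); first by rewrite /t1 /t0 E1; ring.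
    by rewrite T0 T1 addr0.
  have [zN1|zN1] := eqVneq z (-1).
    move=> _ _; have /fv : (-1) ^+ 2 - a * (-1) - b = 0.
      by rewrite -T0 /t0 zN1 E1; ring.
    by case=> h'; [have := zq _ h' zN1|have := z1 _ h' zN1]; tauto.
  rewrite mulf_eq0 [1 + z]addrC [z + 1 == 0]addr_eq0 (negPf zN1) orbF.
  move=> /eqP /fv fu.
  rewrite mulf_eq0 [z - u == 0]subr_eq0.
  case/orP=> [/eqP/fN1 fm|/eqP zu]; last first.
    by case: fu => h'; [have := zq _ h' zu|have := z1 _ h' zu]; tauto.
  have r1z : r = 1 -> zeta = z by rewrite zr => ->; rewrite mul1r.
  have z10 : 1 + z != 0 by rewrite addrC addr_eq0.
  (* The second combination gives q = 1 / u, the others q = u with r = 1. In the first and the last,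
     u = -1, and the missing r = 1 or q = -1 comes from [T0] divided by 1 + z. *)
  case: fm fu => [rq|r1] [urq|ur].
  - have r1 : r = 1.
      apply/eqP; rewrite -subr_eq0 -(mulrI_eq0 _ (mulfI z10)); apply/eqP.
      have ar' : a = -1 - r by rewrite ar mulrBr rq mulr1.
      have br' : b = - r by rewrite br expr2 -mulrA rq mulrN1.
      by rewrite -[RHS]T0 /t0 ar' br' urq rq E1; ring.
    have := r1z r1; move: urq; rewrite r1 mul1r => ->; tauto.
  - have zu : zeta = - z / u.
      by apply: (mulfI r0); rewrite -zr ur; field; rewrite oppr_eq0.
    have qu : q = u^-1.
      by apply: (mulfI r0); rewrite rq ur; field; rewrite oppr_eq0.
    by tauto.
  - by have := r1z r1; move: urq; rewrite r1 mul1r => ->; tauto.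
  - have qu : q = -1.
      apply/eqP; rewrite -addr_eq0 -(mulrI_eq0 _ (mulfI z10)); apply/eqP.
      by rewrite -[RHS]oppr0 -T0 /t0 ar br ur r1 E1; ring.
    by have := r1z r1; rewrite qu ur r1; tauto.
have E10 : 1 - E != 0 by rewrite subr_eq0 eq_sym.
(* The factor 1 - a - b appears in (1 - u) (t0 + t1) + t2, with the nonzero cofactor (1 - E) (1 -
   u). *)
have ab : 1 - b = a.
  apply/eqP; rewrite -subr_eq0 addrAC.
  have : (1 - E) * (1 - u) * (1 - a - b) = 0.
    transitivity ((1 - u) * (t0 + t1) + t2); first by rewrite /t0 /t1 /t2; ring.
    by rewrite T0 T1 T2 !addr0 mulr0.
  move/eqP; rewrite !mulf_eq0 (negPf E10) subr_eq0 eq_sym (negPf u1) /=.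
  by [].
have [zE|zE] := eqVneq (E + z) 0.
  (* With z = - E and 1 - b = a, the equation [T0] reads a (1 + E) = 0. *)
  have a00 : a = 0.
    apply/eqP; rewrite -(mulrI_eq0 _ (mulfI E0)); apply/eqP.
    have -> : E = - z by apply/eqP; rewrite -addr_eq0 zE.
    by rewrite -[RHS]T0 /t0 zE ab; ring.
  have b1 : b = 1 by apply/esym/eqP; rewrite -subr_eq0 ab a00.
  have zE' : z = - E by apply/eqP; rewrite -addr_eq0 addrC zE.
  have [q1 [] r1] := a0 a00 b1.
    have : zeta = - E by rewrite -zE' zr r1 mul1r.
    tauto.
  have : zeta = E by rewrite -[E]opprK -zE' zr r1 mulN1r opprK.
  tauto.
(* This branch is contradictory: b = 1 and a = 0 force u = -1 by [T2], and then [T0] says 2 (E + z)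
   = 0. *)
have b1 : 1 - b = 0.
  by apply/eqP; move/eqP: T3; rewrite !mulf_eq0 (negPf u10) (negPf zE)
    (negPf E10) orbF.
have a00 : a = 0 by rewrite -ab b1.
have uN1 : u = -1.
  have : (u - 1) * (E + z) * ((u - 1) * (u + 1)) = 0.
    by rewrite -[RHS]T2 /t2 a00 -[b](subKr 1) b1; ring.
  move/eqP; rewrite !mulf_eq0 (negPf u10) (negPf zE) /= addr_eq0.
  by move/eqP.
move/eqP: T0; rewrite /t0 b1 a00 uN1 mul0r subr0 add0r mulf_eq0 (negPf zE) orbF.
by rewrite -opprD oppr_eq0 (negPf two0).
Qed.

(** * Comparison of the traces *)

Section Transfer.
Variables (K : fieldType) (d : nat) (u z : K) (x : nat -> K).
Notation Y := (yokonuma d u).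
Notation yg := (@yg K d u _).
Notation ye := (@ye K d u _).
Notation incl := (@yokonuma_incl K d u _).
Variable tr : forall n, {scalar Y n}.
Hypotheses (d_gt0 : (0 < d)%N) (d_neq0 : d%:R != 0 :> K) (u_neq0 : u != 0).
Hypotheses (x_sys : E_system d x) (trP : Juyumaya_trace z x tr).
Notation "a ~~ b" := (tr_equiv tr a b) (at level 70).
Variables (q r : K).
Hypotheses (q_neq0 : q != 0) (r_neq0 : r != 0).
Hypothesis yg_quad_equiv : forall n (i : 'I_n.-1),
  yg i ^+ 2 ~~ (r * (q - 1)) *: yg i + (r ^+ 2 * q)%:A.

Let f n (i : 'I_n.-1) : Y n := r^-1 *: yg i.
(** G_i is sent to g_i / r. As [phi] evaluates a chosen representative, its morphism rules are
    stated modulo the radical, which avoids forming the quotient algebra. *)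
Let phi n (h : hecke q n) : Y n := term_eval (@f n) (palg_repr h).

Let equiv_refl n (a : Y n) : a ~~ a. Proof. by []. Qed.
Let equiv_sym n (a b : Y n) : a ~~ b -> b ~~ a. Proof. by move=> ab c. Qed.
Let equiv_trans n (b a c : Y n) : a ~~ b -> b ~~ c -> a ~~ c.
Proof. by move=> ab bc e; rewrite ab. Qed.
Let equivM n (a a' b b' : Y n) : a ~~ a' -> b ~~ b' -> a * b ~~ a' * b'.
Proof. exact: (tr_equivM trP). Qed.

Let term_eval_cong n (s t : aterm K 'I_n.-1) :
  tcong (@hecke_rel K q n) s t -> term_eval (@f n) s ~~ term_eval (@f n) t.
Proof.
elim=> {s t} //=.
- move=> s t [i j ij|i j ij|i] /=.
  + by rewrite /f -!scalerAl -!scalerAr yg_comm.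
  + by rewrite /f -!scalerAl -!scalerAr -!scalerAl yg_braid // ij eqxx ?orbT.
  + rewrite scale1r mulr1 -expr2 /f exprZn -!scalerAl mul1r scalerA.
    have := tr_equivZ (r^-1 ^+ 2) (yg_quad_equiv i).
    rewrite scalerDr !scalerA.
    have -> : r^-1 ^+ 2 * (r * (q - 1)) = (q - 1) * r^-1 by field.
    by have -> : r^-1 ^+ 2 * (r ^+ 2 * q) = q by field.
- by move=> s t _ /equiv_sym.
- by move=> s t v _ st _ tv; apply: equiv_trans st tv.
- by move=> *; apply: tr_equivD.
- by move=> *; apply: equivM.
- by move=> *; rewrite addrA.
- by move=> *; rewrite addrC.
- by move=> *; rewrite scale0r add0r.
- by move=> *; rewrite mulrA.
- by move=> *; rewrite scale1r mul1r.
- by move=> *; rewrite scale0r mul0r.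
- by move=> *; rewrite mulrDl.
- by move=> *; rewrite mulrDr.
- by move=> *; rewrite scalerDl.
- by move=> *; rewrite -scalerAl mul1r scalerA.
- by move=> *; rewrite -scalerAl -scalerAr mul1r mulr1.
Qed.

Let phi_of n t : phi (palg_of (@hecke_rel K q n) t) ~~ term_eval (@f n) t.
Proof. exact/term_eval_cong/palg_repr_of. Qed.

Let phiG n (i : 'I_n.-1) : phi (hG q i) ~~ r^-1 *: yg i.
Proof. exact: phi_of. Qed.

Let phiM n (a b : hecke q n) : phi (a * b) ~~ phi a * phi b.
Proof.
rewrite -[a](palg_reprK) -[b](palg_reprK) -palg_ofM.
by apply: equiv_trans (phi_of _) _; apply: equivM; apply/equiv_sym/phi_of.
Qed.

Let phiD n (a b : hecke q n) : phi (a + b) ~~ phi a + phi b.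
Proof.
rewrite -[a](palg_reprK) -[b](palg_reprK) -palg_ofD.
by apply: equiv_trans (phi_of _) _; apply: tr_equivD; apply/equiv_sym/phi_of.
Qed.

Let phiZ n c (a : hecke q n) : phi (c *: a) ~~ c *: phi a.
Proof.
rewrite -[a](palg_reprK) -palg_ofZ.
apply: equiv_trans (phi_of _) _; rewrite /= -scalerAl mul1r.
by apply: tr_equivZ; apply/equiv_sym/phi_of.
Qed.

Let phi1 n : phi (1 : hecke q n) ~~ 1.
Proof. by have := @phi_of n (Tcst 1); rewrite palg_of1 /= scale1r. Qed.

Let phi_incl n (h : hecke q n) : phi (hecke_incl h) ~~ incl (phi h).
Proof.
have inclE (a b : Y n) : a ~~ b -> incl a ~~ incl b.
  exact: (tr_equiv_incl d_gt0 x_sys trP).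
elim/hecke_ind: h => [i|c|a b IHa IHb|a b IHa IHb].
- rewrite hecke_inclG; apply: equiv_trans (phiG _) _.
  rewrite -yokonuma_inclg -linearZ; exact/inclE/equiv_sym/phiG.
- rewrite linearZ /= rmorph1; apply: equiv_trans (phiZ _ _) _.
  apply: (@equiv_trans _ (incl (c%:A : Y n))); last first.
    by apply/inclE/equiv_sym/(equiv_trans (phiZ _ _))/tr_equivZ/phi1.
  by rewrite linearZ /= rmorph1; apply/tr_equivZ/phi1.
- rewrite raddfD; apply: equiv_trans (phiD _ _) _.
  apply: (@equiv_trans _ (incl (phi a + phi b))); last first.
    exact/inclE/equiv_sym/phiD.
  by rewrite raddfD; apply: tr_equivD.
- rewrite rmorphM; apply: equiv_trans (phiM _ _) _.
  apply: (@equiv_trans _ (incl (phi a * phi b))); last first.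
    exact/inclE/equiv_sym/phiM.
  by rewrite rmorphM; apply: equivM.
Qed.

Let trphi_linear n : GRing.linear_for *%R (fun h : hecke q n => tr n (phi h)).
Proof.
move=> c a b; have := tr_equiv_tr (phiD (c *: a) b) => ->.
by rewrite linearD /= (tr_equiv_tr (phiZ c a)) linearZ.
Qed.

Let trphi n : {scalar hecke q n} :=
  HB.pack (fun h : hecke q n => tr n (phi h))
    (GRing.isLinear.Build K (hecke q n) K *%R _ (@trphi_linear n)).

Let trphi_Ocneanu : Ocneanu_trace (r^-1 * z) trphi.
Proof.
split=> [n h|n a b|n|n h] /=.
- by rewrite (tr_equiv_tr (phi_incl h)) (tr_incl trP).
- by rewrite !(tr_equiv_tr (phiM _ _)) (trC trP).
- by rewrite (tr_equiv_tr (@phi1 n)) (tr1 trP).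
rewrite (tr_equiv_tr (phiM _ _)) (tr_equiv_tr (equivM (phi_incl _) (phiG _))).
by rewrite -scalerAr linearZ /= (tr_yg trP) mulrA.
Qed.

(** Multiplying the quadratic congruence by [yg_inv] gives g = r (q - 1) + r^2 q g^-1, which turns
    q^-1 (g / r - (q - 1)) into r g^-1. *)
Let phiG_inv n (i : 'I_n.-1) : phi (hG_inv q i) ~~ r *: yg_inv d u i.
Proof.
apply: equiv_trans (phiZ _ _) _.
apply: (@equiv_trans _ (q^-1 *: (r^-1 *: yg i + (1 - q)%:A))).
  apply: tr_equivZ; rewrite -scaleNr opprB; apply: equiv_trans (phiD _ _) _.
  apply: tr_equivD; first exact: phiG.
  exact/(equiv_trans (phiZ _ _))/tr_equivZ/phi1.
have := equivM (equiv_refl (yg_inv d u i)) (yg_quad_equiv i).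
rewrite expr2 mulrA yg_mulVl // mul1r mulrDr -!scalerAr yg_mulVl // mulr1.
move=> gE; apply: equiv_trans.
  exact: (tr_equivZ _ (tr_equivD (tr_equivZ _ gE) (equiv_refl _))).
move: (yg_inv d u i) => v; rewrite !scalerDr !scalerA addrAC -scalerDl.
have -> : q^-1 / r * (r * (q - 1)) + q^-1 * (1 - q) = 0 by field; apply/andP.
have -> : q^-1 / r * (r ^+ 2 * q) = r by field; apply/andP.
by rewrite scale0r add0r.
Qed.

(** By uniqueness the pullback of [tr] along [phi] is tau. On a braid word each letter contributes
    r^-1 or r, in total r to the power minus the exponent sum. *)
Lemma tr_braid_yokonuma zeta (tau : forall n, {scalar hecke q n}) :
    Ocneanu_trace zeta tau -> z = r * zeta ->
  forall n (alpha : braid n),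
  tr n (braid_yokonuma d u alpha)
  = r ^ epsilon alpha * tau n (braid_hecke q alpha).
Proof.
move=> tauP zr n; have zE : r^-1 * z = zeta by rewrite zr mulKf.
elim/braid_ind=> w; rewrite braid_yokonumaE // braid_heckeE // epsilon_braid_of.
have := trphi_Ocneanu; rewrite zE => /(Ocneanu_trace_unique tauP) -> /=.
have -> : tr n (phi (word_eval (@hG K q n) (@hG_inv K q n) w))
  = tr n (r ^ (- exponent_sum w)
          *: word_eval (@Defs.yg K d u n) (@yg_inv K d u n) w).
  apply: tr_equiv_tr; elim: w => [|[i b] w IHw].
    by rewrite /word_eval /exponent_sum !big_nil scale1r; apply: phi1.
  rewrite /word_eval /exponent_sum !big_cons /= -!/(word_eval _ _ _).
  rewrite -/(exponent_sum w) opprD expfzDr // -scalerA scalerAr scalerAl.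
  apply: equiv_trans (phiM _ _) _; apply: equivM => //.
  by case: b; [apply: phiG|apply: phiG_inv].
by rewrite linearZ /= mulrA -expfzDr // subrr mul1r.
Qed.

End Transfer.

(** A root of the quadratic relation defines a one-dimensional representation G_i |-> c; being
    multiplicative, it satisfies the Ocneanu rules with parameter c. *)
Lemma hecke_char (K : fieldType) (q c : K) : q != 0 -> c != 0 ->
    c ^+ 2 = (q - 1) * c + q ->
  exists2 chi : forall n, {scalar hecke q n}, Ocneanu_trace c chi
  & forall n (alpha : braid n), chi n (braid_hecke q alpha) = c ^ epsilon alpha.
Proof.
move=> q0 c0 cq; pose f n (i : 'I_n.-1) : K^o := c.
have fr n s t : @hecke_rel K q n s t -> term_eval (@f n) s = term_eval (@f n) t.
  case=> // i; rewrite term_evalX /= /f cq /GRing.scale /=.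
  by rewrite !mulr1.
have lin n : GRing.linear_for *%R (palg_lift (@f n) : hecke q n -> K).
  exact: (palg_lift_linear (@fr n)).
pose chi n : {scalar hecke q n} := HB.pack (palg_lift (@f n) : hecke q n -> K)
  (GRing.isLinear.Build K (hecke q n) K *%R _ (lin n)).
have chi1 n : chi n 1 = 1 by case: (palg_lift_monoid (@fr n)).
have chiM n a b : chi n (a * b) = chi n a * chi n b.
  by case: (palg_lift_monoid (@fr n)) => _; apply.
have chiG n i : chi n (hG q i) = c by exact: (palg_liftE (@fr n) (Tgen i)).
have chiI n (h : hecke q n) : chi n.+1 (hecke_incl h) = chi n h.
  elim/hecke_ind: h => [i|k|a b IHa IHb|a b IHa IHb].
  - by rewrite hecke_inclG !chiG.
  - have -> : hecke_incl (k%:A : hecke q n) = k%:A.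
      by rewrite linearZ /= rmorph1.
    by rewrite ![chi _ _]linearZ !chi1.
  - have -> : hecke_incl (a + b) = hecke_incl a + hecke_incl b.
      by rewrite raddfD.
    by rewrite ![chi _ (_ + _)]linearD IHa IHb.
  - by rewrite rmorphM !chiM IHa IHb.
exists chi.
  by split=> // [n a b|n h]; rewrite !chiM ?chiG ?chiI mulrC.
move=> n; elim/braid_ind=> w; rewrite braid_heckeE // epsilon_braid_of.
elim: w => [|[i b] w IHw].
  by rewrite /word_eval /exponent_sum !big_nil chi1.
rewrite /word_eval /exponent_sum !big_cons -/(word_eval _ _ _) chiM IHw.
rewrite expfzDr //; congr (_ * _).
case: b; rewrite [X in chi n X]/= [X in c ^ X]/= ?chiG //.
apply: (mulfI c0); rewrite -{1}(chiG n i) -chiM hG_mulV // chi1.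
by rewrite -[RHS]/(c * c^-1) mulfV.
Qed.

(** * Equality of the invariants in terms of the traces *)

Section Comparison.
Variables (K : fieldType) (d : nat) (u z : K) (x : nat -> K).
Variable tr : forall n, {scalar yokonuma d u n}.
Hypotheses (d_gt0 : (0 < d)%N) (d_neq0 : d%:R != 0 :> K) (u_neq0 : u != 0).
Hypothesis z_neq0 : z != 0.
Hypotheses (x_sys : E_system d x) (trP : Juyumaya_trace z x tr).
Variables (q zeta : K) (tau : forall n, {scalar hecke q n}).
Hypotheses (q_neq0 : q != 0) (zeta_neq0 : zeta != 0).
Hypothesis tauP : Ocneanu_trace zeta tau.
Variables sH sY : K.
Hypotheses (sH_neq0 : sH != 0) (sY_neq0 : sY != 0).
Notation E := (trace_ye d x).
Notation P := (HOMFLYPT zeta sH tau).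
Notation D := (Delta z sY tr).
Notation r := (z / zeta).

Let r_neq0 : r != 0. Proof. by rewrite mulf_neq0 ?invr_eq0. Qed.
Let zr : z = r * zeta. Proof. by rewrite divfK. Qed.

Lemma HOMFLYPT1 n : P (1 : braid n)%g = (1 / (zeta * sH)) ^ (n%:Z - 1).
Proof.
have [_ _ t1 _] := tauP.
rewrite /HOMFLYPT braid_hecke1 // t1 mulr1 -braid_of_nil epsilon_braid_of.
by rewrite /exponent_sum big_nil mulr1.
Qed.

Lemma Delta1 n : D (1 : braid n)%g = (1 / (z * sY)) ^ (n%:Z - 1).
Proof.
rewrite /Delta braid_yokonuma1 // (tr1 trP) mulr1 -braid_of_nil.
by rewrite epsilon_braid_of /exponent_sum big_nil mulr1.
Qed.

Let epsilon_sigma n (i : 'I_n.-1) : epsilon (sigma i) = 1.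
Proof. by rewrite epsilon_braid_of /exponent_sum big_seq1. Qed.

(** The closure of s_1 is the unknot, on which both invariants are normalized to 1. *)
Lemma HOMFLYPT_sigma : P (sigma (ord_max : 'I_2.-1)) = 1.
Proof.
have [_ _ t1 tG] := tauP.
rewrite /HOMFLYPT braid_hecke_sigma // epsilon_sigma expr1z.
rewrite -[hG q _]mul1r -(rmorph1 (@hecke_incl K q 1)) tG t1 mulr1.
by rewrite /= expr1z; field; rewrite zeta_neq0 sH_neq0.
Qed.

Lemma Delta_sigma : D (sigma (ord_max : 'I_2.-1)) = 1.
Proof.
rewrite /Delta braid_yokonuma_sigma // epsilon_sigma expr1z.
rewrite -[yg _ _ _]mul1r -(rmorph1 (@yokonuma_incl K d u 1)).
by rewrite (tr_yg trP) (tr1 trP) mulr1 /= expr1z; field; rewrite z_neq0 sY_neq0.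
Qed.

(** The braid s_1 gives c_2 = 1, the trivial braid on two strands then equates the two factors D,
    and the trivial braid on n strands gives c_n = 1. *)
Lemma proportional_eq (c : nat -> K) :
  (forall n (alpha : braid n), P alpha = c n * D alpha) ->
  zeta * sH = z * sY /\ forall n (alpha : braid n), P alpha = D alpha.
Proof.
move=> PcD; have c2 : c 2 = 1.
  have := PcD 2 (sigma (ord_max : 'I_2.-1)).
  by rewrite HOMFLYPT_sigma Delta_sigma mulr1.
have ss : zeta * sH = z * sY.
  have := PcD 2 1%g; rewrite c2 mul1r HOMFLYPT1 Delta1 /= !expr1z !div1r.
  exact: invr_inj.
split=> // n alpha; suff c1 : c n = 1 by rewrite PcD c1 mul1r.
have := PcD n 1%g; rewrite HOMFLYPT1 Delta1 ss => h.
have C0 : (1 / (z * sY)) ^ (n%:Z - 1) != 0.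
  by rewrite expfz_neq0 // div1r invr_eq0 mulf_neq0.
by apply: (mulIf C0); rewrite -h [RHS]mul1r.
Qed.

Hypothesis ss : zeta * sH = z * sY.

(** Since [sH = sY * r], both invariants share a nonzero factor that can be cancelled. *)
Lemma HOMFLYPT_eqE :
  (forall n (alpha : braid n), P alpha = D alpha) <->
  (forall n (alpha : braid n),
     tr n (braid_yokonuma d u alpha)
     = r ^ epsilon alpha * tau n (braid_hecke q alpha)).
Proof.
have sE : sH = sY * r by apply: (mulfI zeta_neq0); rewrite ss; field.
have C0 n k : (1 / (z * sY)) ^ (n%:Z - 1) * sY ^ k != 0.
  by rewrite mulf_neq0 // expfz_neq0 // div1r invr_eq0 mulf_neq0.
have PE n (alpha : braid n) : P alpha
   = (1 / (z * sY)) ^ (n%:Z - 1) * sY ^ epsilon alpha *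
     (r ^ epsilon alpha * tau n (braid_hecke q alpha)).
  by rewrite /HOMFLYPT ss {1}sE expfzMl !mulrA.
split=> PD n alpha; last by rewrite PE -PD.
by apply: (mulfI (C0 n (epsilon alpha))); rewrite -PE PD.
Qed.

(** The Hecke quadratic relation is carried over by comparing the traces on the positive words w, w
    s_i and w s_i^2. *)
Lemma HOMFLYPT_eq_skein : (forall n (alpha : braid n), P alpha = D alpha) ->
  forall n (w : seq 'I_n.-1) (i : 'I_n.-1),
  tr n (\prod_(j <- w) yg d u j * yg d u i ^+ 2)
  = r * (q - 1) * tr n (\prod_(j <- w) yg d u j * yg d u i)
    + r ^+ 2 * q * tr n (\prod_(j <- w) yg d u j).
Proof.
move=> /HOMFLYPT_eqE trE n w i.
have wordE (v : seq 'I_n.-1) : tr n (\prod_(j <- v) yg d u j)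
    = r ^+ size v * tau n (\prod_(j <- v) hG q j).
  pose bw := [seq (j, true) | j <- v] : braid_word n.
  have := trE n (braid_of bw).
  rewrite braid_yokonumaE // braid_heckeE // epsilon_braid_of.
  rewrite /word_eval /exponent_sum !big_map /=.
  by rewrite [X in _ ^ X]big_const_seq count_predT iter_addr_0 natz.
have wi := wordE (w ++ [:: i]); have wii := wordE (w ++ [:: i; i]).
rewrite !big_cat !big_cons !big_nil /= !mulr1 !size_cat in wi wii.
rewrite !expr2 wii wi wordE -[hG q i * _]expr2 hG_quad mulrDr -!scalerAr mulr1.
rewrite linearD !linearZ /= addn1 addn2 !exprS.
by move: (tau _ _) (tau _ _) (_ ^+ _) => t1 t2 v; ring.
Qed.

Lemma HOMFLYPT_eq_cases : 2 != 0 :> K -> 1 + E != 0 ->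
    (forall n (alpha : braid n), P alpha = D alpha) ->
  parameter_cases q zeta u z E.
Proof.
move=> two0 E0 /HOMFLYPT_eq_skein skein.
apply: (skein_equations_solve two0 E0 q_neq0 u_neq0 r_neq0 zr erefl erefl).
- exact: (skein_eq0 d_gt0 d_neq0 x_sys trP skein).
- exact: (skein_eq1 d_gt0 d_neq0 x_sys trP skein).
- exact: (skein_eq2 d_gt0 d_neq0 x_sys trP skein).
- exact: (skein_eq3 d_gt0 d_neq0 x_sys trP skein).
Qed.

Lemma HOMFLYPT_eq_of_skein :
    (forall n (i : 'I_n.-1), tr_equiv tr (yg d u i ^+ 2)
       ((r * (q - 1)) *: yg d u i + (r ^+ 2 * q)%:A)) ->
  forall n (alpha : braid n), P alpha = D alpha.
Proof.
move=> yq; apply/HOMFLYPT_eqE => n alpha.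
exact: (tr_braid_yokonuma d_gt0 d_neq0 u_neq0 x_sys trP q_neq0 r_neq0 yq
          tauP zr).
Qed.

(** Here tau of a braid is zeta to the exponent sum, and [tr], transferred to H_n(u) with ratio 1,
    is z to the exponent sum. *)
Lemma HOMFLYPT_eq_of_characters : zeta = q \/ zeta = -1 -> z = u \/ z = -1 ->
    (forall n (i : 'I_n.-1), tr_equiv tr (yg d u i ^+ 2)
       ((u - 1) *: yg d u i + u%:A)) ->
  forall n (alpha : braid n), P alpha = D alpha.
Proof.
have char_root (k c : K) : c = k \/ c = -1 -> c ^+ 2 = (k - 1) * c + k.
  by case=> ->; ring.
move=> /char_root zq /char_root zu yq; apply/HOMFLYPT_eqE => n alpha.
have [chi chiP chiE] := hecke_char q_neq0 zeta_neq0 zq.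
have [psi psiP psiE] := hecke_char u_neq0 z_neq0 zu.
have yq1 m (i : 'I_m.-1) : tr_equiv tr (yg d u i ^+ 2)
    ((1 * (u - 1)) *: yg d u i + (1 ^+ 2 * u)%:A).
  by rewrite expr1n !mul1r; apply: yq.
rewrite (tr_braid_yokonuma d_gt0 d_neq0 u_neq0 x_sys trP u_neq0 (oner_neq0 K)
           yq1 psiP) ?mul1r //.
rewrite (Ocneanu_trace_unique tauP chiP) psiE chiE exp1rz mul1r.
by rewrite -expfzMl divfK.
Qed.

(** Three mechanisms cover the list: [skein_u1] for (1), (2), (13), (14), [opp] for (7), (8), and
    [chars] for the rest. *)
Lemma HOMFLYPT_eq_of_cases :
    (E = 1 -> exists w, forall k, x (k %% d) = w ^+ k) ->
  parameter_cases q zeta u z E -> forall n (alpha : braid n), P alpha = D alpha.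
Proof.
move=> E1w cases.
have quad_u1 : u = 1 \/ E = 1 -> forall n (i : 'I_n.-1),
    tr_equiv tr (yg d u i ^+ 2) ((u - 1) *: yg d u i + u%:A).
  move=> h n i; case: h => [u1|/E1w[w xw]].
    by apply: (tr_equiv_yg_quad d_gt0 d_neq0 x_sys trP (w := 1)); left.
  by apply: (tr_equiv_yg_quad d_gt0 d_neq0 x_sys trP (w := w)); right.
have skein_u1 : u = 1 \/ E = 1 -> r * (q - 1) = u - 1 -> r ^+ 2 * q = u ->
    forall n (alpha : braid n), P alpha = D alpha.
  by move=> h ra rb; apply: HOMFLYPT_eq_of_skein; rewrite ra rb; apply: quad_u1.
have opp : q = 1 -> z = - E -> r ^+ 2 = 1 ->
    forall n (alpha : braid n), P alpha = D alpha.
  move=> q1 zE r1; apply: HOMFLYPT_eq_of_skein => n i.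
  have -> : r ^+ 2 * q = 1 by rewrite r1 q1 mulr1.
  rewrite q1 subrr mulr0 scale0r add0r scale1r.
  exact: (tr_equiv_yg_quad_opp d_gt0 d_neq0 x_sys trP).
have rN : zeta = - z -> r = -1 by move=> ->; rewrite invrN mulrN divff.
have r1 : zeta = z -> r = 1 by move=> ->; rewrite divff.
have chars : zeta = q \/ zeta = -1 -> z = u \/ z = -1 -> u = 1 \/ E = 1 ->
    forall n (alpha : braid n), P alpha = D alpha.
  by move=> h1 h2 /quad_u1; apply: HOMFLYPT_eq_of_characters.
case: cases => [[q1 [/r1 rE u1]]|cases].
  by apply: skein_u1; [left|..]; rewrite // ?rE ?q1 ?u1 ?expr1n ?mulr1 ?subrr
     ?mulr0.
case: cases => [[q1 [/rN rE u1]]|cases].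
  by apply: skein_u1; [left|..]; rewrite // ?rE ?q1 ?u1 ?sqrrN ?expr1n ?mulr1
     ?subrr ?mulr0.
do 4 (case: cases => [[h1 [h2 h3]]|cases];
  first by apply: chars; rewrite ?h2; tauto).
case: cases => [[q1 [h2 h3]]|cases].
  by apply: opp => //; rewrite rN ?sqrrN ?expr1n // h2 h3 opprK.
case: cases => [[q1 [h2 h3]]|cases].
  by apply: opp => //; rewrite r1 ?expr1n // h2 h3.
do 4 (case: cases => [[h1 [h2 h3]]|cases]; first by apply: chars; tauto).
case: cases => [[qu [/r1 rE E1]]|[qu [zetaE E1]]].
  by apply: skein_u1; [right|..]; rewrite // ?rE ?qu ?expr1n ?mul1r.
have rE : r = - u by rewrite zetaE; field; rewrite ?oppr_eq0 ?u_neq0 ?z_neq0.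
by apply: skein_u1; [right| |]; rewrite ?rE ?qu //; field.
Qed.

End Comparison.

(** * Solutions of the E-system *)

(** This is the condition under which the square roots are chosen compatibly. *)
Lemma lambda_eq_of_cases (K : fieldType) (q zeta u z E : K) :
    q != 0 -> zeta != 0 -> u != 0 -> z != 0 -> parameter_cases q zeta u z E ->
  zeta ^+ 2 * lambda_H q zeta = z ^+ 2 * lambda_Y u z E.
Proof.
move=> q0 zeta0 u0 z0 cases.
have -> : zeta ^+ 2 * lambda_H q zeta = zeta * (zeta + (1 - q)) / q.
  by rewrite /lambda_H; field; rewrite q0 zeta0.
have -> : z ^+ 2 * lambda_Y u z E = z * (z + (1 - u) * E) / u.
  by rewrite /lambda_Y; field; rewrite u0 z0.
apply/eqP; rewrite eqr_div //; apply/eqP.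
do 12 (case: cases => [[h1 [h2 h3]]|cases];
  first by rewrite ?h1 ?h2 ?h3; ring).
by case: cases => -[-> [-> ->]]; [ring|field].
Qed.

Lemma sum_unity_root (K : fieldType) (d : nat) (v : K) :
  v ^+ d = 1 -> \sum_(s < d) v ^+ s = if v == 1 then d%:R else 0.
Proof.
move=> vd; have [->|v1] := eqVneq v 1.
  by under eq_bigr do rewrite expr1n; rewrite sumr_const card_ord.
have := subrX1 v d; rewrite vd subrr => /esym/eqP.
by rewrite mulf_eq0 subr_eq0 (negPf v1) => /eqP.
Qed.

Section ESolutionTrace.
Variables (R : realType) (d : nat) (S : {set 'I_d}) (x : nat -> R[i]).
Hypotheses (d_gt0 : (0 < d)%N) (S_neq0 : S != set0).
Hypothesis xS : forall m : nat, (m < d)%N -> x m = E_solution R S m.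

Let w : R[i] := expi (2 * trigo.pi / d%:R).

Let xE m : x (m %% d) = (#|S|%:R)^-1 * \sum_(k in S) w ^+ (k * m).
Proof.
rewrite xS ?ltn_mod // E_solutionE //; congr (_ * _); apply: eq_bigr => k _.
by apply/eqP; rewrite (eq_prim_root_expr (expi_prim R d_gt0)) modnMmr.
Qed.

(** Expanding x gives a double sum over k and l in S. Orthogonality of the powers of w leaves the
    diagonal, that is |S| terms equal to d. *)
Lemma trace_ye_E_solution : trace_ye d x = (#|S|%:R)^-1.
Proof.
have wP : d.-primitive_root w := expi_prim R d_gt0.
have wd : w ^+ d = 1 := prim_expr_order wP.
have w0 : w != 0.
  apply/eqP=> w0; move/eqP: wd.
  by rewrite w0 expr0n gtn_eqF // eq_sym oner_eq0.
have d0 : d%:R != 0 :> R[i] by rewrite pnatr_eq0 -lt0n.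
have S0 : #|S|%:R != 0 :> R[i] by rewrite pnatr_eq0 cards_eq0.
have orth (k l : 'I_d) :
    \sum_(s < d) w ^+ (k * s) * w ^+ (l * (d - s)) = if l == k then d%:R else 0.
  transitivity (\sum_(s < d) (w ^+ k / w ^+ l) ^+ s).
    apply: eq_bigr => s _; rewrite exprMn exprVn -!exprM; congr (_ * _).
    apply: (mulIf (expf_neq0 (l * s) w0)); rewrite mulVf ?expf_neq0 // -exprD.
    by rewrite -mulnDr subnK ?(ltnW (ltn_ord s)) // mulnC exprM wd expr1n.
  rewrite sum_unity_root; last first.
    by rewrite exprMn exprVn (exprAC w k) (exprAC w l) wd !expr1n divr1.
  congr (if _ then _ else _); rewrite -[RHS]eq_sym -val_eqE /=.
  rewrite -(inj_eq (mulIf (expf_neq0 l w0))) divfK ?expf_neq0 // mul1r.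
  by rewrite (eq_prim_root_expr wP) !modn_small.
rewrite /trace_ye.
transitivity (d%:R^-1 * (d%:R * (#|S|%:R)^-1) : R[i]); last by rewrite mulKf.
congr (_ * _).
transitivity (\sum_(s < d) (#|S|%:R)^-1 * (#|S|%:R)^-1 *
   \sum_(k in S) \sum_(l in S) w ^+ (k * s) * w ^+ (l * (d - s))).
  apply: eq_bigr => s _; rewrite -{1}(modn_small (ltn_ord s)) !xE mulrACA.
  by rewrite big_distrlr.
rewrite -mulr_sumr exchange_big /=.
transitivity ((#|S|%:R)^-1 * (#|S|%:R)^-1 * \sum_(k in S) d%:R : R[i]).
  congr (_ * _); apply: eq_bigr => k kS; rewrite exchange_big /= (bigD1 k) //=.
  rewrite orth eqxx big1 ?addr0 // => l /andP[_ lk].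
  by rewrite orth (negPf lk).
by rewrite sumr_const -mulr_natr; field.
Qed.

(** E = 1 / |S|, so E = 1 forces S to be a singleton {k}, and then x_m = w^(k m). *)
Lemma E_solution_power :
  trace_ye d x = 1 -> exists v, forall m, x (m %% d) = v ^+ m.
Proof.
rewrite trace_ye_E_solution => /(congr1 (@GRing.inv _)); rewrite invrK invr1.
move/eqP; rewrite pnatr_eq1 => /cards1P[k Sk]; exists (w ^+ k) => m.
by rewrite xE Sk cards1 invr1 mul1r big_set1 exprM.
Qed.

End ESolutionTrace.

Theorem theorem6 (R : realType) (d : nat) (hd : (0 < d)%N)
    (S : {set 'I_d}) (hS : S != set0)
    (x : nat -> R[i]) (hx : E_system d x)
    (hxS : forall m : nat, (m < d)%N -> x m = E_solution R S m)
    (q zeta u z : R[i])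
    (hq : q != 0) (hzeta : zeta != 0) (hu : u != 0) (hz : z != 0)
    (tau : forall n : nat, {scalar hecke q n}) (htau : Ocneanu_trace zeta tau)
    (tr : forall n : nat, {scalar yokonuma d u n})
    (htr : Juyumaya_trace z x tr)
    (E : R[i]) (hE : E = trace_E tr)
    (hlH : lambda_H q zeta != 0) (hlY : lambda_Y u z E != 0)
    (sH sY : R[i])
    (hsH : sH ^+ 2 = lambda_H q zeta) (hsY : sY ^+ 2 = lambda_Y u z E)
    (hs : zeta ^+ 2 * lambda_H q zeta = z ^+ 2 * lambda_Y u z E ->
          zeta * sH = z * sY) :
  ((exists c : nat -> R[i], forall (n : nat) (alpha : braid n),
      HOMFLYPT zeta sH tau alpha = c n * Delta z sY tr alpha)
   <->
   (forall (n : nat) (alpha : braid n),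
      HOMFLYPT zeta sH tau alpha = Delta z sY tr alpha))
  /\
  ((forall (n : nat) (alpha : braid n),
      HOMFLYPT zeta sH tau alpha = Delta z sY tr alpha)
   <->
   (   (q = 1 /\ zeta = z /\ u = 1)
    \/ (q = 1 /\ zeta = - z /\ u = 1)
    \/ (zeta = q /\ u = 1 /\ z = 1)
    \/ (zeta = q /\ u = 1 /\ z = - 1)
    \/ (zeta = - 1 /\ u = 1 /\ z = 1)
    \/ (zeta = - 1 /\ u = 1 /\ z = - 1)
    \/ (q = 1 /\ zeta = E /\ z = - E)
    \/ (q = 1 /\ zeta = - E /\ z = - E)
    \/ (zeta = q /\ z = - 1 /\ E = 1)
    \/ (zeta = q /\ z = u /\ E = 1)
    \/ (zeta = - 1 /\ z = - 1 /\ E = 1)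
    \/ (zeta = - 1 /\ z = u /\ E = 1)
    \/ (q = u /\ zeta = z /\ E = 1)
    \/ (q = u^-1 /\ zeta = - z / u /\ E = 1))).
Proof.
have d0 : d%:R != 0 :> R[i] by rewrite pnatr_eq0 -lt0n.
have sH0 : sH != 0 by rewrite -sqrf_eq0 hsH.
have sY0 : sY != 0 by rewrite -sqrf_eq0 hsY.
have {}hE : E = trace_ye d x by rewrite hE (trace_E_ye hd hx htr).
(* Positivity of E = 1 / |S| provides [1 + E != 0]. *)
have E_gt0 : 0 < E.
  by rewrite hE (trace_ye_E_solution hd hS hxS) invr_gt0 ltr0n card_gt0.
have prop := proportional_eq d0 hu hz htr hq hzeta htau sH0 sY0.
have PDss : (forall n (alpha : braid n),
    HOMFLYPT zeta sH tau alpha = Delta z sY tr alpha) -> zeta * sH = z * sY.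
  by move=> PD; case: (prop (fun=> 1)) => // n alpha; rewrite mul1r PD.
split; first split=> [[c /prop[]]//|PD].
  by exists (fun=> 1) => n alpha; rewrite mul1r PD.
split=> [PD|cases].
  have := HOMFLYPT_eq_cases hd d0 hu hz hx htr hq hzeta sY0 (PDss PD).
  rewrite -hE; apply=> //; first by rewrite pnatr_eq0.
  by rewrite gt_eqF // addr_gt0.
have ss : zeta * sH = z * sY.
  by apply: hs; apply: lambda_eq_of_cases.
apply: (HOMFLYPT_eq_of_cases hd d0 hu hz hx htr hq hzeta htau sY0 ss).
  exact: (E_solution_power hd hS hxS).
by rewrite -hE.
Qed.
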